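(* Let $G$ be a theta-free and prism-free graph, and let $W=(H,c)$ be a non-special wheel in $G$ such that the hole $H$ has length at least seven. Let $a,b\in V(G)\setminus N[Z(W)]$ belong to the interiors of two distinct sectors of $W$. Then $N[Z(W)]$ separates $a$ and $b$ in $G$.
   Context: Graphs are finite and simple. A path in $G$ is an induced subgraph that is a path; its interior is its set of non-end vertices; a hole is an induced cycle of length at least four. A theta is a graph consisting of two non-adjacent vertices $a,b$ and three pairwise internally disjoint paths from $a$ to $b$, each of length at least two, whose interiors are pairwise anticomplete. A prism is a graph consisting of two triangles $\{a_1,a_2,a_3\}$, $\{b_1,b_2,b_3\}$ and three pairwise disjoint paths $P_1,P_2,P_3$, where $P_i$ has ends $a_i,b_i$ (length zero allowed), such that for distinct $i,j$ the only edges between $P_i$ and $P_j$ are $a_ia_j$ and $b_ib_j$, and $P_i\cup P_j$ induces a hole. $G$ is theta-free (prism-free) if it has no induced subgraph isomorphic to a theta (prism). A wheel in $G$ is a pair $W=(H,c)$ where $H$ is a hole in $G$ and $c\in V(G)\setminus V(H)$ has at least three neighbors in $H$. A sector of $W$ is a path of non-zero length in $H$ whose ends are adjacent to $c$ and whose interior vertices are not. $W$ is special if it has exactly three sectors, one of length one and the other two of length at least two; otherwise it is non-special. For a non-special wheel, $Z(W)=N_H[c]$, i.e. $c$ together with its neighbors in $H$. For $X\subseteq V(G)$, $N[X]$ is $X$ together with all vertices having a neighbor in $X$. A separation of $G$ is a triple $(L,M,R)$ of pairwise disjoint sets with union $V(G)$, $L,R$ non-empty and no edges between $L$ and $R$;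 a set $M\subseteq V(G)\setminus\{x,y\}$ separates $x$ and $y$ if there is a separation $(L,M,R)$ with $x\in L$, $y\in R$. *)

(* Defs.v *)
From mathcomp Require Import all_boot.

Set Implicit Arguments.
Unset Strict Implicit.
Unset Printing Implicit Defensive.

(* A finite simple graph is a finType of vertices with a symmetric and
   irreflexive adjacency relation e.  Induced subgraphs are represented by
   their vertex sets. *)

Section Graphs.

Variables (T : finType) (e : rel T).
Implicit Types (a b c u v x y : T) (s p : seq T) (A B H L M P R S X : {set T}).

Definition simple_graph := symmetric e /\ irreflexive e.

Definition anticomplete A B :=
  forall x y, x \in A -> y \in B -> ~~ e x y.

(* The vertices of s are distinct, and two of them are adjacent exactly when
   they are consecutive in s. *)
Definition induced_path s : Prop :=
  uniq s /\
  {in s &, forall x y,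
     e x y = ((index x s).+1 == index y s) || ((index y s).+1 == index x s)}.

(* As induced_path, but consecutive in the cyclic order. *)
Definition induced_cycle s : Prop :=
  uniq s /\ {in s &, forall x y, e x y = (next s x == y) || (next s y == x)}.

Definition path_between a b P : Prop :=
  exists p, [/\ induced_path (a :: p), last a p = b & P = [set x in a :: p]].

(* Number of edges of a path with vertex set P. *)
Definition path_length P := #|P|.-1.

(* Interior of a path P with ends a and b. *)
Definition interior a b P := P :\: [set a; b].

Definition hole H : Prop :=
  exists s, [/\ 4 <= size s, induced_cycle s & H = [set x in s]].

(* X induces a theta.  The pairwise intersections being exactly the two ends
   says that the three paths are internally disjoint. *)
Definition theta X : Prop :=
  exists a b (P : 'I_3 -> {set T}),
  [/\ a != b /\ ~~ e a b,
      forall i, path_between a b (P i) /\ 2 <= path_length (P i),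
      forall i j, i != j -> P i :&: P j = [set a; b],
      forall i j, i != j ->
        anticomplete (interior a b (P i)) (interior a b (P j))
    & X = \bigcup_i P i].

(* X induces a prism.  Since a i = b i is allowed, a path may have length
   zero. *)
Definition prism X : Prop :=
  exists (a b : 'I_3 -> T) (P : 'I_3 -> {set T}),
  [/\ forall i j, i != j -> e (a i) (a j) /\ e (b i) (b j),
      forall i, path_between (a i) (b i) (P i),
      forall i j, i != j -> [disjoint P i & P j],
      forall i j, i != j ->
        hole (P i :|: P j) /\
        (forall x y, x \in P i -> y \in P j -> e x y ->
           (x = a i /\ y = a j) \/ (x = b i /\ y = b j))
    & X = \bigcup_i P i].

Definition theta_free := forall X, ~ theta X.

Definition prism_free := forall X, ~ prism X.

Definition wheel H c :=
  [/\ hole H, c \notin H & 3 <= #|[set x in H | e c x]|].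

(* S is a sector, with ends u and v, of the wheel (H, c). *)
Definition sector_between H c u v S :=
  [/\ path_between u v S, S \subset H, 0 < path_length S, e c u && e c v
    & {in interior u v S, forall x, ~~ e c x}].

Definition sector H c S := exists u v, sector_between H c u v S.

Definition special H c :=
  exists S1 S2 S3,
  [/\ uniq [:: S1; S2; S3],
      forall S, sector H c S <-> S \in [:: S1; S2; S3],
      path_length S1 = 1, 2 <= path_length S2 & 2 <= path_length S3].

(* The set Z(W) of a non-special wheel W = (H, c). *)
Definition wheelZ H c := c |: [set x in H | e c x].

(* N[X]. *)
Definition closed_nbhd X := X :|: [set y | [exists x in X, e y x]].

Definition separation L M R :=
  [/\ [/\ [disjoint L & M], [disjoint L & R] & [disjoint M & R]],
      L :|: M :|: R = [set: T], L != set0, R != set0 & anticomplete L R].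

Definition separates M x y :=
  M \subset ~: [set x; y] /\
  exists L R, [/\ separation L M R, x \in L & y \in R].

End Graphs.

(* Main.v *)
Require Import Defs.
From mathcomp Require Import all_boot.
From mathcomp Require Import zify.

(* If N[Z(W)] does not separate a and b, take a shortest path Q, with ends q and
   q', that avoids H and N[Z(W)] and attaches to the interiors of two distinct
   sectors S (at q) and S' (at q').  Non-speciality forces c to have a neighbour
   in H \ N[S]: otherwise the neighbours of c in H induce two disjoint edges of H
   and H together with c is a prism with a path of length zero.  If q' also has a
   neighbour in H \ N[S], then the neighbours of q in S are two adjacent vertices;
   otherwise there is a theta between c and either q (two non-adjacent
   neighbours) or the unique neighbour of q in S, the third path using Q and
   H \ N[S].  If q' has no such neighbour, then q and q' have a unique neighbour
   in each sector interior they see, and one gets a theta with two such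
   neighbours as ends, or q = q' and |H| = 6.  Finally, if all the attachments are
   pairs of adjacent vertices, then H and Q form a prism when only two sectors are
   seen, and a single vertex q = q' seeing three sectors gives a theta between q
   and c. *)

Set Implicit Arguments.
Unset Strict Implicit.
Unset Printing Implicit Defensive.


(** * Induced paths, thetas *)

Section InducedPaths.

Variables (T : finType) (e : rel T).
Hypothesis e_simple : simple_graph e.
Implicit Types (x y z : T) (p s : seq T) (A B : {set T}).

Lemma adjC x y : e x y = e y x.
Proof. by case: e_simple => sym _; apply: sym. Qed.

Lemma adjxx x : e x x = false.
Proof. by case: e_simple => _ ->. Qed.

Lemma induced_pathP x0 s :
  induced_path e s <->
  uniq s /\ forall i j, i < size s -> j < size s ->
    e (nth x0 s i) (nth x0 s j) = (i.+1 == j) || (j.+1 == i).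
Proof.
split=> -[us es]; split=> //.
  by move=> i j ltis ltjs; rewrite es ?mem_nth // !index_uniq.
move=> x y xs ys; rewrite -{1}(nth_index x0 xs) -{1}(nth_index x0 ys).
by rewrite es ?index_mem.
Qed.

Lemma induced_path_cons x y p :
  x \notin y :: p -> e x y -> {in p, forall z, ~~ e x z} ->
  induced_path e (y :: p) -> induced_path e (x :: y :: p).
Proof.
move=> xnp exy xp /(induced_pathP x)[up ep]; apply/(induced_pathP x).
split=> [|[|i] [|j] // lti ltj]; first by rewrite /= xnp.
- by rewrite /= adjxx.
- case: j ltj => [|j] ltj //=; rewrite (negPf (xp _ _)) //.
  exact: mem_nth.
- case: i lti => [|i] lti /=; first by rewrite adjC exy.
  by rewrite adjC (negPf (xp _ _)) //; apply: mem_nth.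
- by rewrite /= ep.
Qed.

Lemma induced_path_behead x y p :
  induced_path e (x :: y :: p) -> induced_path e (y :: p).
Proof.
move=> /(induced_pathP x)[/= /andP[_ up] ep]; apply/(induced_pathP x).
by split=> // i j lti ltj; rewrite (ep i.+1 j.+1).
Qed.

Lemma induced_path_catr p x s : induced_path e (p ++ x :: s) -> induced_path e (x :: s).
Proof.
elim: p => // y [|z p] IHp /=; first exact: induced_path_behead.
by move/induced_path_behead.
Qed.

Lemma induced_path_rev s : induced_path e s -> induced_path e (rev s).
Proof.
case: s => // x s; set t := x :: s => /(induced_pathP x)[us es].
apply/(induced_pathP x); rewrite rev_uniq size_rev; split=> // i j lti ltj.
rewrite !nth_rev // es; lia.
Qed.

Lemma induced_path_path x p : induced_path e (x :: p) -> path e x p.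
Proof.
move=> /(induced_pathP x)[_ ep]; apply/(pathP x) => i ltip.
by rewrite -[nth x p i]/(nth x (x :: p) i.+1) ep ?eqxx // ltnS // ltnW.
Qed.

(** Supplies the last neighbour of a vertex along a path, from which the path can be continued
    without a chord. *)
Lemma last_split (P : pred T) s :
  has P s -> exists s1 x s2, [/\ s = s1 ++ x :: s2, P x & ~~ has P s2].
Proof.
elim: s => // x s IHs /=; case: (boolP (has P s)) => [Ps _ | nPs].
  by have [s1 [y [s2 [-> Py nP]]]] := IHs Ps; exists (x :: s1), y, s2.
by rewrite orbF => Px; exists [::], x, s.
Qed.

(** Both ends of every edge used lie in [A], but the relation is reflexive everywhere, also outside
    [A]; hence the separate membership hypotheses in later lemmas. *)
Definition conn A := connect [rel x y | [&& x \in A, y \in A & e x y]].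

Lemma conn_sym A x y : conn A x y = conn A y x.
Proof.
by apply: sym_connect_sym => u v /=; rewrite adjC andbCA.
Qed.

Lemma conn1 A x y : x \in A -> y \in A -> e x y -> conn A x y.
Proof. by move=> xA yA exy; apply: connect1; rewrite /= xA yA. Qed.

Lemma conn_trans A : transitive (conn A).
Proof. by move=> y x z; apply: connect_trans. Qed.

Lemma conn_refl A x : conn A x x. Proof. exact: connect0. Qed.

Lemma conn_sub A B x y : A \subset B -> conn A x y -> conn B x y.
Proof.
move=> /subsetP sAB; apply: connect_sub => u v /= /and3P[uA vA euv].
by apply: conn1 => //; apply: sAB.
Qed.

(** Invariant form of connectedness: to confine a component to [K], it is enough that no edge of [A]
    leaves [K]. *)
Lemma conn_closed A (K : {pred T}) x y :
  (forall u v, u \in A -> v \in A -> e u v -> u \in K -> v \in K) ->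
  conn A x y -> x \in K -> y \in K.
Proof.
move=> clK /connectP[p]; elim: p x => [|z p IHp] x /=; first by move=> _ ->.
case/andP=> /and3P[xA zA exz] pz yl xK; apply: IHp pz yl _.
exact: clK exz xK.
Qed.

Lemma conn_in A x y : conn A x y -> x \in A -> y \in A.
Proof. by apply: (conn_closed (K := mem A)). Qed.

Lemma path_conn A x p :
  path e x p -> (forall u, u \in x :: p -> u \in A) ->
  forall u v, u \in x :: p -> v \in x :: p -> conn A u v.
Proof.
move=> pxp sA; suff xc u : u \in x :: p -> conn A x u.
  by move=> u v /xc xu /xc; apply: conn_trans; rewrite conn_sym.
elim: p x pxp sA u => [|y p IHp] x /=.
  by move=> _ _ u; rewrite inE => /eqP->; apply: conn_refl.
case/andP=> exy pyp sA u; rewrite inE => /predU1P[->|uyp].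
  exact: conn_refl.
have sA' : (forall u, u \in y :: p -> u \in A) by move=> z zp; apply: sA; rewrite inE zp orbT.
apply: (@conn_trans _ y); last exact: IHp.
by apply: conn1 => //; apply: sA; rewrite !inE eqxx ?orbT.
Qed.

(** Induction on a walk: the new first vertex either already lies on the induced path, whose initial
    piece is then dropped, or is joined to its last neighbour there, which leaves no chord. *)
Lemma conn_induced_path A x y :
  conn A x y -> x \in A ->
  exists p, [/\ induced_path e (x :: p), last x p = y & (forall u, u \in x :: p -> u \in A)].
Proof.
case/connectP=> p; elim: p x => [|z p IHp] x /=.
  move=> _ -> xA; exists [::]; split=> //; last first.
    by move=> u; rewrite inE => /eqP->.
  by apply/(induced_pathP x); split=> // [[|i]] [|j] //=; rewrite adjxx.
case/andP=> /and3P[_ zA exz] pz yl xA.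
have [q [iq lq sq]] := IHp _ pz yl zA.
case: (boolP (x \in z :: q)) => [xq|xnq].
  case/splitPr: {-1}(z :: q) / xq (erefl (z :: q)) => q1 q2 zq.
  exists q2; split.
  - by move: iq; rewrite zq; apply: induced_path_catr.
  - have: last z (z :: q) = y by [].
    by rewrite zq last_cat /=.
  - by move=> u uq; apply: sq; rewrite zq mem_cat uq orbT.
have /last_split[q1 [u [q2 [zq xu xq2]]]] : has (e x) (z :: q) by rewrite /= exz.
have sq2 : (forall w, w \in u :: q2 -> w \in z :: q) by move=> v vq; rewrite zq mem_cat vq orbT.
exists (u :: q2); split.
- apply: induced_path_cons => //.
  + by apply: contra xnq; apply: sq2.
  + by apply/hasPn.
  + by move: iq; rewrite zq; apply: induced_path_catr.
- have: last z (z :: q) = y by [].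
  by rewrite zq last_cat /=.
- move=> v; rewrite inE => /predU1P[->//|vq]; apply: sq; exact: sq2.
Qed.

(** * Assembling a theta from three connected sets *)

Lemma forall_I3 (P : 'I_3 -> Prop) :
  P (inord 0) -> P (inord 1) -> P (inord 2) -> forall i, P i.
Proof.
move=> P0 P1 P2 i; rewrite -[i]inord_val.
by case: i => [[|[|[|i]]]] //=.
Qed.

Lemma forall_I3_pair (P : 'I_3 -> 'I_3 -> Prop) :
  (forall i j, P i j -> P j i) ->
  P (inord 0) (inord 1) -> P (inord 0) (inord 2) -> P (inord 1) (inord 2) ->
  forall i j, i != j -> P i j.
Proof.
move=> Psym P01 P02 P12; apply: forall_I3; apply: forall_I3;
  rewrite ?eqxx // => _; by [ | exact: Psym].
Qed.

Definition far A B := [disjoint A & B] /\ anticomplete e A B.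

(* Only connectedness of the three sets is needed: shortest paths inside them
   replace the choice of closest neighbours. *)
Lemma theta_of_conn x y (A : seq {set T}) (u v : seq T) :
  x != y -> ~~ e x y ->
  (forall i, i < 3 ->
    [/\ (x \notin nth set0 A i) && (y \notin nth set0 A i),
        e x (nth x u i), e y (nth x v i), nth x u i \in nth set0 A i
      & conn (nth set0 A i) (nth x u i) (nth x v i)]) ->
  (far (nth set0 A 0) (nth set0 A 1)) ->
  (far (nth set0 A 0) (nth set0 A 2)) ->
  (far (nth set0 A 1) (nth set0 A 2)) ->
  exists X, theta e X.
Proof.
move=> xy nexy cA f01 f02 f12.
have exP (i : 'I_3) : exists P : {set T},
  [/\ path_between e x y P, x \in P, y \in P, 2 <= path_length P
    & interior x y P \subset nth set0 A i].
  have [/andP[xA yA] exu eyv uA cuv] := cA i (ltn_ord i).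
  set B := nth set0 A i in xA yA uA cuv; set ui := nth x u i in exu uA cuv.
  set vi := nth x v i in eyv cuv.
  have vA := conn_in cuv uA.
  have sB : B \subset B :|: [set x; y] by apply: subsetUl.
  have cxy : conn (B :|: [set x; y]) x y.
    apply: (@conn_trans _ ui); first by apply: conn1; rewrite // !inE ?uA ?eqxx ?orbT.
    apply: (@conn_trans _ vi); first exact: conn_sub cuv.
    by apply: conn1; rewrite 1?adjC // !inE ?vA ?eqxx ?orbT.
  have [|p [ip lp sp]] := conn_induced_path cxy; first by rewrite !inE eqxx orbT.
  have yp : y \in x :: p by rewrite -lp mem_last.
  exists [set z in x :: p]; split.
  - by exists p.
  - by rewrite !inE eqxx.
  - by rewrite inE.
  (* Length zero is excluded by [x != y], length one by non-adjacency. *)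
  - rewrite /path_length cardsE; case: (ip) => up _; rewrite (card_uniqP up) /=.
    case: p ip lp {sp yp up} => [|z [|w p]] //=; first by move=> _ /eqP; rewrite (negPf xy).
    by move=> /induced_path_path /= /andP[exz _] zy; rewrite -zy exz in nexy.
  - apply/subsetP => z; rewrite !inE negb_or => /andP[/andP[zx zy] zp].
    have := sp z; rewrite !inE (negPf zx) (negPf zy) !orbF => ->//.
    by rewrite (negPf zx) in zp.
have {exP} [P PP] : exists P : 'I_3 -> {set T}, forall i,
  [/\ path_between e x y (P i), x \in P i, y \in P i, 2 <= path_length (P i)
    & interior x y (P i) \subset nth set0 A i].
  have [P0 h0] := exP (inord 0); have [P1 h1] := exP (inord 1).
  have [P2 h2] := exP (inord 2).
  exists (fun i => nth set0 [:: P0; P1; P2] i).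
  by apply: forall_I3; [move: h0 | move: h1 | move: h2]; rewrite !inordK.
have fP : forall i j, i != j ->
  P i :&: P j = [set x; y] /\ anticomplete e (interior x y (P i)) (interior x y (P j)).
  have fij (i j : 'I_3) : far (nth set0 A i) (nth set0 A j) -> 
    P i :&: P j = [set x; y] /\ anticomplete e (interior x y (P i)) (interior x y (P j)).
    have [_ xi yi _ /subsetP si] := PP i; have [_ xj yj _ /subsetP sj] := PP j.
    case=> dij aij; split; last by move=> w z /si wi /sj zj; apply: aij.
    apply/setP => z; rewrite 2!inE; apply/andP/idP; last first.
      by rewrite !inE => /orP[] /eqP->.
    case=> zi zj; apply/negPn/negP => nz.
    have /si zAi : z \in interior x y (P i) by rewrite inE zi andbT inE nz.
    have /sj zAj : z \in interior x y (P j) by rewrite inE zj andbT inE nz.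
    by move: dij => /pred0P/(_ z); rewrite /= zAi zAj.
  apply: forall_I3_pair.
  - move=> i j [Pij aij]; rewrite setIC; split=> // w z wj zi.
    by rewrite adjC; apply: aij.
  - by apply: fij; rewrite !inordK.
  - by apply: fij; rewrite !inordK.
  - by apply: fij; rewrite !inordK.
exists (\bigcup_i P i), x, y, P; split=> //.
- by move=> i; have [] := PP i.
- by move=> i j /fP[].
- by move=> i j /fP[].
Qed.

End InducedPaths.


(** * Holes and their cyclic enumerations *)

Section Cycles.

Variables (T : finType) (e : rel T).
Hypothesis e_simple : simple_graph e.
Implicit Types (x y z : T) (p s : seq T) (A B H : {set T}) (h : nat -> T).

Let adjC := adjC e_simple.
Let adjxx := adjxx e_simple.

(* Shifting h (cyc_shift) moves the origin of the enumeration, so that claims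
   about H become linear arithmetic on indices in [0, n). *)
Definition cyclic_enum n h H :=
  [/\ 4 <= n, forall i, h (n + i) = h i,
      forall x, x \in H <-> exists2 i, i < n & x = h i,
      forall i j, i < n -> j < n -> h i = h j -> i = j
    & forall i j, i < n -> j < n ->
        e (h i) (h j) = [|| i.+1 == j, j.+1 == i,
                            (i == 0) && (j.+1 == n) | (j == 0) && (i.+1 == n)]].

Lemma next_nth_mod x0 s i : uniq s -> i < size s ->
  next s (nth x0 s i) = nth x0 s (if i.+1 == size s then 0 else i.+1).
Proof.
move=> us lti; rewrite next_nth mem_nth //.
case: s us lti => // y p us lti; rewrite (index_uniq _ lti us).
rewrite [size _]/= eqSS; case: eqP => [->|ne]; first by rewrite nth_default.
rewrite /=; apply: set_nth_default; move: lti => /=; lia.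
Qed.

Lemma hole_cyc H : hole e H -> exists h, cyclic_enum #|H| h H.
Proof.
case=> s [s4 [us es] ->]; have Hs : #|[set x in s]| = size s.
  by rewrite cardsE; apply/card_uniqP.
have [x0 _] : exists x0, x0 \in s by case: s s4 {us es Hs} => // x; exists x; apply: mem_head.
move: Hs s4; have [n sn] : exists n, size s = n by exists (size s).
rewrite sn => -> n4.
(* Reading the list modulo its length makes the enumeration periodic, so that it can be shifted
   freely. *)
exists (fun i => nth x0 s (i %% n)).
have md i : i < n -> i %% n = i by apply: modn_small.
split=> //.
- by move=> i; rewrite modnDl.
- move=> x; rewrite inE; split=> [xs | [i lti ->]]; last first.
    by rewrite mem_nth // md // sn.
  by exists (index x s); rewrite -?sn ?index_mem // sn md -?sn ?index_mem // nth_index.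
- by move=> i j lti ltj; rewrite !md // => /eqP; rewrite nth_uniq ?sn // => /eqP.
- move=> i j lti ltj; rewrite !md // es ?mem_nth ?sn // !next_nth_mod ?sn //.
  case: (i.+1 =P n) => [ei|nei]; case: (j.+1 =P n) => [ej|nej];
    rewrite !nth_uniq ?sn //; lia.
Qed.

Lemma cyc_hole n h H : cyclic_enum n h H -> hole e H.
Proof.
case=> n4 _ memH injh eh; exists (mkseq h n).
have um : uniq (mkseq h n) by apply/(mkseq_uniqP h n) => i j; apply: injh.
split; first by rewrite size_mkseq.
  split=> // x y /(nthP (h 0))[i]; rewrite size_mkseq => lti <-.
  case/(nthP (h 0))=> j; rewrite size_mkseq => ltj <-.
  have eqh i' j' : i' < n -> j' < n -> (h i' == h j') = (i' == j').
    by move=> lti' ltj'; apply/eqP/eqP => [/injh->|->].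
  rewrite !next_nth_mod ?size_mkseq //.
  case: (i.+1 =P n) => [ei|nei]; case: (j.+1 =P n) => [ej|nej];
    rewrite !nth_mkseq ?eh ?eqh //; lia.
apply/setP => x; rewrite inE; apply/idP/idP => [/memH[i lti ->]|].
  by apply: map_f; rewrite mem_iota.
by case/(nthP (h 0))=> j; rewrite size_mkseq => ltj <-; apply/memH; exists j;
  rewrite // nth_mkseq.
Qed.

Lemma cyc_shift1 n h H : cyclic_enum n h H -> cyclic_enum n (fun i => h i.+1) H.
Proof.
case=> n4 hn memH injh eh.
have h0 : h n = h 0 by rewrite -[LHS]/(h n) -[n in h n]addn0.
(* The shifted index is brought back below [n], where injectivity and the adjacency rule apply. *)
have hS i : i < n -> h i.+1 = h (if i.+1 == n then 0 else i.+1).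
  by case: eqP => // ->.
split=> //.
- by move=> i; rewrite -addnS.
- move=> x; rewrite memH; split=> -[i lti ->].
    case: i lti => [|i] lti; last by exists i => //; apply: ltnW.
    by exists n.-1; [lia | rewrite prednK ?h0 //; lia].
  exists (if i.+1 == n then 0 else i.+1); last exact: hS.
  case: eqP; lia.
- move=> i j lti ltj; rewrite !hS //.
  by case: eqP => ei; case: eqP => ej /injh; lia.
- move=> i j lti ltj; rewrite !hS //.
  case: eqP => ei; case: eqP => ej; rewrite eh //; lia.
Qed.

Lemma cyc_shift k n h H : cyclic_enum n h H -> cyclic_enum n (fun i => h (k + i)) H.
Proof.
elim: k h => [|k IHk] h ch //.
exact: IHk (cyc_shift1 ch).
Qed.

Lemma path_between_seq x0 s : induced_path e s -> 0 < size s ->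
  path_between e (nth x0 s 0) (nth x0 s (size s).-1) [set x in s].
Proof. by case: s => // x p ip _; exists p; split=> //=; rewrite (last_nth x0). Qed.

Lemma path_between_sym x y A : path_between e x y A -> path_between e y x A.
Proof.
case=> p [ip lp ->]; have := path_between_seq x (induced_path_rev ip).
rewrite size_rev !nth_rev ?subnn //= subn1 /=.
rewrite -(last_nth x) lp => /(_ isT).
by congr path_between; apply/setP=> z; rewrite !inE mem_rev.
Qed.

(** Read cyclically, [p ++ r] enumerates the hole: the only edges across join the end of each list
    to the start of the other. *)
Lemma hole_cat x0 p r :
  induced_path e p -> induced_path e r -> 4 <= size p + size r ->
  (forall x, x \in p -> x \notin r) ->
  (forall i j, i < size p -> j < size r -> e (nth x0 p i) (nth x0 r j) =
     (i == 0) && (j.+1 == size r) || (i.+1 == size p) && (j == 0)) ->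
  0 < size p -> 0 < size r ->
  hole e ([set x in p] :|: [set x in r]).
Proof.
move=> /(induced_pathP e x0)[up ep] /(induced_pathP e x0)[ur er] s4 dpr epr p0 r0.
set n := size p + size r; apply: (@cyc_hole n (fun i => nth x0 (p ++ r) (i %% n))).
have us : uniq (p ++ r).
  rewrite cat_uniq up ur andbT /=; apply/hasPn => x; exact/contraL/dpr.
have sn : size (p ++ r) = n by rewrite size_cat.
have md i : i < n -> i %% n = i by apply: modn_small.
split=> //.
- by move=> i; rewrite modnDl.
- move=> x; rewrite !inE -mem_cat; split=> [xs | [i lti ->]]; last first.
    by rewrite mem_nth // md // sn.
  by exists (index x (p ++ r)); rewrite ?md -?sn ?index_mem // nth_index.
- by move=> i j lti ltj; rewrite !md // => /eqP; rewrite nth_uniq ?sn // => /eqP.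
move=> i j lti ltj; rewrite !md // !nth_cat.
case: ltnP => ip; case: ltnP => jp.
- rewrite ep //; lia.
- rewrite epr //; lia.
- rewrite adjC epr //; lia.
- rewrite er; lia.
Qed.

(** * Arcs of a hole, and the prism they form with an attached path *)

Definition seg h a m : seq T := [seq h i | i <- iota a m].

Lemma size_seg h a m : size (seg h a m) = m.
Proof. by rewrite size_map size_iota. Qed.

Lemma nth_seg x0 h a m i : i < m -> nth x0 (seg h a m) i = h (a + i).
Proof. by move=> lti; rewrite (nth_map 0) ?size_iota // nth_iota. Qed.

Lemma mem_seg h a m x :
  x \in seg h a m <-> exists i, a <= i < a + m /\ x = h i.
Proof.
split=> [/mapP[i]|[i [ai ->]]]; first by rewrite mem_iota; exists i.
by apply: map_f; rewrite mem_iota.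
Qed.

(** An arc that misses a vertex does not contain the edge closing the cycle. *)
Lemma seg_induced n h H a m : cyclic_enum n h H -> m < n -> induced_path e (seg h a m).
Proof.
move=> /(cyc_shift a)[n4 _ memH injh eh] mn.
apply/(induced_pathP e (h 0)); rewrite size_seg; split.
  rewrite map_inj_in_uniq ?iota_uniq // => i j; rewrite !mem_iota => ia ja eij.
  suff: i - a = j - a by lia.
  by apply: injh; rewrite ?subnKC //; lia.
by move=> i j lti ltj; rewrite !nth_seg // eh; lia.
Qed.

(** The triangles are [q0], [h 0], [h n.-1] and [last q0 q], [h j], [h j.+1]; the paths are
    [q0 :: q] and the two arcs of H between the triangles. The bounds on [j] give each arc at least
    three vertices, so it closes to a hole even with a path of length zero. *)
Lemma prism_cyc n h H q0 q j :
  cyclic_enum n h H -> 2 <= j -> j + 4 <= n -> induced_path e (q0 :: q) ->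
  (forall r, r \in q0 :: q -> r \notin H) ->
  (forall r i, r \in q0 :: q -> i < n ->
     e r (h i) = (r == q0) && ((i == 0) || (i.+1 == n))
              || (r == last q0 q) && ((i == j) || (i == j.+1))) ->
  exists X, prism e X.
Proof.
move=> ch j2 jn iQ QH eQ; have [n4 _ memH injh eh] := ch.
pose p := seg h 0 j.+1; pose r := seg h j.+1 (n - j.+1).
have ip : induced_path e p by apply: (seg_induced _ ch); lia.
have ir : induced_path e r by apply: (seg_induced _ ch); lia.
have sp : size p = j.+1 by apply: size_seg.
have sr : size r = n - j.+1 by apply: size_seg.
have pr x : x \in p -> x \notin r.
  move/mem_seg=> [i [ij ->]]; apply/negP=> /mem_seg[i' [ij' /injh]]; lia.
have pH x : x \in p -> x \in H.
  by move/mem_seg=> [i [ij ->]]; apply/memH; exists i => //; lia.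
have rH x : x \in r -> x \in H.
  by move/mem_seg=> [i [ij ->]]; apply/memH; exists i => //; lia.
have Qp x : x \in q0 :: q -> x \notin p by move/QH; apply/contra/pH.
have Qr x : x \in q0 :: q -> x \notin r by move/QH; apply/contra/rH.
have iQ' := iQ; case/(induced_pathP e q0): iQ' => uQ eQQ.
have eqq0 t : t < (size q).+1 -> (nth q0 (q0 :: q) t == q0) = (t == 0).
  move=> ltt; have /= := nth_uniq q0 (ltt : t < size (q0 :: q)) (ltn0Sn _ : 0 < size (q0 :: q)) uQ; exact.
have eqqk t : t < (size q).+1 -> (nth q0 (q0 :: q) t == last q0 q) = (t == size q).
  move=> ltt; rewrite (last_nth q0).
  exact: (nth_uniq q0 (ltt : t < size (q0 :: q)) (ltnSn _ : size q < size (q0 :: q)) uQ).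
pose P (i : 'I_3) := nth set0 [:: [set x in q0 :: q]; [set x in p]; [set x in r]] i.
pose a (i : 'I_3) := nth q0 [:: q0; h 0; h n.-1] i.
pose b (i : 'I_3) := nth q0 [:: last q0 q; h j; h j.+1] i.
have q0Q : q0 \in q0 :: q by apply: mem_head.
have qkQ : last q0 q \in q0 :: q by apply: mem_last.
exists (\bigcup_i P i), a, b, P; split=> //.
- apply: forall_I3_pair.
  + by move=> i i' []; rewrite (adjC (a i)) (adjC (b i)).
  + rewrite /a /b !inordK //= !eQ //; last lia; last lia.
    by rewrite !eqxx ?orbT.
  + by rewrite /a /b !inordK //= !eQ //; try lia; rewrite !eqxx; split; lia.
  + by rewrite /a /b !inordK //= !eh //; lia.
- apply: forall_I3; rewrite /a /b /P !inordK //=.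
  + by exists q.
  + have := path_between_seq q0 ip; rewrite sp !nth_seg //= add0n; exact.
  (* [r] runs from [h j.+1] up to [h n.-1], against the direction from [a] to [b]. *)
  + apply: path_between_sym; have := path_between_seq q0 ir.
    rewrite sr !nth_seg //=; try lia.
    rewrite addn0 (_ : j.+1 + _ = n.-1); last lia.
    by apply; lia.
- have dsj s1 s2 : (forall x, x \in s1 -> x \notin s2) -> [disjoint [set x in s1] & [set x in s2]].
    move=> d12; apply/pred0P=> x; rewrite /= !inE; apply/negP => /andP[/d12].
    by move/negP.
  apply: forall_I3_pair; first by move=> i i'; rewrite disjoint_sym.
  + by rewrite /P !inordK //=; apply: dsj.
  + by rewrite /P !inordK //=; apply: dsj.
  + by rewrite /P !inordK //=; apply: dsj.
- apply: forall_I3_pair.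
  + move=> i i' [hii' aii']; rewrite setUC; split=> // x y xP yP.
    by rewrite adjC => /(aii' _ _ yP xP) [] []; [left | right].
  + rewrite /P /a /b !inordK //=; split.
      (* The path is reversed so that it continues the arc [p] in cyclic order, from [h j] back to
         [h 0]. *)
      rewrite setUC (_ : [set x in q0 :: q] = [set x in rev (q0 :: q)]); last first.
        by apply/setP=> x; rewrite !inE mem_rev inE.
      apply: (@hole_cat q0); rewrite ?size_rev ?sp //=.
      * exact: induced_path_rev.
      * lia.
      * by move=> x xp; rewrite mem_rev; apply: contraL xp; apply: Qp.
      * move=> i t lti ltt; rewrite nth_rev //= nth_seg // add0n subSS adjC.
        have lt' : size q - t < (size q).+1 by lia.
        rewrite eQ; [|exact: mem_nth|lia].
        rewrite eqq0 // eqqk //; lia.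
    move=> x y; rewrite !in_set => xQ /mem_seg[i [ij ->]].
    rewrite eQ //; last lia.
    case/orP=> /andP[/eqP-> ii]; [left | right]; split=> //; congr h; lia.
  + rewrite /P /a /b !inordK //=; split.
      apply: (@hole_cat q0); rewrite ?sr //=.
      * lia.
      * move=> i t lti ltt; rewrite nth_seg //.
        rewrite eQ; [|exact: mem_nth|lia].
        rewrite eqq0 // eqqk //; lia.
      * lia.
    move=> x y; rewrite !in_set => xQ /mem_seg[i [ij ->]].
    rewrite eQ //; last lia.
    case/orP=> /andP[/eqP-> ii]; [left | right]; split=> //; congr h; lia.
  + rewrite /P /a /b !inordK //=; split.
      apply: (@hole_cat q0); rewrite ?sp ?sr //=.
      * lia.
      * move=> i t lti ltt; rewrite !nth_seg // eh; lia.
      * lia.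
    move=> x y; rewrite !in_set => /mem_seg[i [ij ->]] /mem_seg[i' [ij' ->]].
    rewrite eh; [|lia|lia] => ee.
    have [[-> ->]|[-> ->]] : (i = 0 /\ i' = n.-1) \/ (i = j /\ i' = j.+1) by lia.
      by left.
    by right.
Qed.

End Cycles.


(** * Sectors of a wheel *)

Section Wheels.

Variables (T : finType) (e : rel T) (H : {set T}) (c : T).
Hypothesis e_simple : simple_graph e.
Implicit Types (x y z u v w : T) (p s m : seq T) (A B S : {set T}) (h : nat -> T).

Let adjC := adjC e_simple.
Let adjxx := adjxx e_simple.

Definition nonZ := [set x in H | ~~ e c x].
(* The classes of this relation on nonZ are the non-empty interiors of the
   sectors. *)
Definition same_sector := conn e nonZ.

Lemma same_sector_sym x y : same_sector x y = same_sector y x. Proof. exact: conn_sym. Qed.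

Lemma same_sector_refl x : same_sector x x. Proof. exact: conn_refl. Qed.

Lemma same_sector_trans x y z : same_sector x y -> same_sector y z -> same_sector x z.
Proof. exact: conn_trans. Qed.

Lemma same_sector_nonZ x y : same_sector x y -> x \in nonZ -> y \in nonZ.
Proof. exact: conn_in. Qed.

Lemma cyc_in n h i : cyclic_enum e n h H -> h i \in H.
Proof.
move=> /(cyc_shift i)[n4 _ memH _ _]; apply/memH; exists 0; rewrite ?addn0 //; lia.
Qed.

Lemma cyc_adjS n h i : cyclic_enum e n h H -> e (h i) (h i.+1).
Proof.
move=> /(cyc_shift i)[n4 _ _ _ eh]; have := eh 0 1; rewrite addn0 addn1 => -> //; lia.
Qed.

Lemma cyc_at n h x : cyclic_enum e n h H -> x \in H -> exists2 k, k < n & x = h k.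
Proof. by move=> [_ _ memH _ _] /memH. Qed.

Lemma cyc_inj n h i j : cyclic_enum e n h H -> i < n -> j < n -> (h i == h j) = (i == j).
Proof.
by move=> [_ _ _ injh _] lti ltj; apply/eqP/eqP => [/injh->|->].
Qed.

Lemma conn_seg n h (B : {set T}) a b : cyclic_enum e n h H ->
  (forall i, a <= i <= b -> h i \in B) ->
  forall i j, a <= i <= b -> a <= j <= b -> conn e B (h i) (h j).
Proof.
move=> ch hB; suff ca i : a <= i <= b -> conn e B (h a) (h i).
  by move=> i j /ca ai /ca; apply: conn_trans; rewrite conn_sym.
elim: i => [|i IHi] ab; first by rewrite (_ : a = 0) ?conn_refl //; lia.
have [->|ai] := eqVneq a i.+1; first exact: conn_refl.
apply: (conn_trans (IHi _)); first lia.
by apply: conn1; rewrite ?hB ?(cyc_adjS _ ch) //; lia.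
Qed.

Lemma nonZE n h i : cyclic_enum e n h H -> (h i \in nonZ) = ~~ e c (h i).
Proof. by move=> ch; rewrite inE (cyc_in _ ch). Qed.

Lemma same_sector_seg n h a b : cyclic_enum e n h H ->
  (forall i, a <= i <= b -> ~~ e c (h i)) -> 
  forall i j, a <= i <= b -> a <= j <= b -> same_sector (h i) (h j).
Proof.
by move=> ch nec; apply: (conn_seg ch) => i ab; rewrite (nonZE _ ch) nec.
Qed.

(** A component can leave the open arc only through [h a] or [h b], and these are adjacent to
    [c]. *)
Lemma same_sector_between n h a b i w : cyclic_enum e n h H -> b < n ->
  e c (h a) -> e c (h b) -> a < i < b -> same_sector (h i) w ->
  exists2 j, a < j < b & w = h j.
Proof.
move=> ch bn eca ecb iab ciw; have [n4 _ memH injh eh] := ch.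
pose K := [set h (val j) | j : 'I_n & a < j < b].
suff /imsetP[j] : w \in K by rewrite inE => jab ->; exists j.
apply: (conn_closed _ ciw); last first.
  have ltin : i < n by lia.
  by apply/imsetP; exists (Ordinal ltin); rewrite ?inE.
move=> u v _; rewrite inE => /andP[/memH[k ltk ->] nck] euv /imsetP[[j ltj]].
rewrite inE /= => jab uj; move: euv; rewrite uj eh // => ekj.
have ka : k != a by apply: contraNneq nck => ->.
have kb : k != b by apply: contraNneq nck => ->.
by apply/imsetP; exists (Ordinal ltk); rewrite ?inE //=; lia.
Qed.

(** The enumeration starts at one end of a sector, the other end being [h l]. The bound [2 <= l]
    makes the interior non-empty, and [l < n] makes the ends distinct. *)
Definition sector_frame n h l :=
  [/\ cyclic_enum e n h H, e c (h 0), e c (h l), forall i, 0 < i < l -> ~~ e c (h i)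
    & 2 <= l < n].

Lemma frame_same_sector n h l i j : sector_frame n h l -> 0 < i < l -> 0 < j < l -> same_sector (h i) (h j).
Proof.
move=> [ch _ _ nec ln] il jl.
by apply: (same_sector_seg ch (a := 1) (b := l.-1)) => [k kl||]; first apply: nec; lia.
Qed.

Lemma frame_same_sector_out n h l i w : sector_frame n h l -> 0 < i < l -> same_sector (h i) w ->
  exists2 j, 0 < j < l & w = h j.
Proof. by move=> [ch ec0 ecl _ /andP[_ ln]]; apply: (same_sector_between ch). Qed.

Lemma cyc_degree2 n h x u v w : cyclic_enum e n h H -> x \in H -> u \in H -> v \in H ->
  w \in H -> e x u -> e x v -> e x w -> u != v -> (w == u) || (w == v).
Proof.
move=> ch /(cyc_at ch)[k _ ->].
(* The origin is placed just before [x], so that its two neighbours are [h1 0] and [h1 2], without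
   wrap-around. *)
have [h1 [ch1 ->]] : exists h1, cyclic_enum e n h1 H /\ h k = h1 1.
  exists (fun i => h (k + n.-1 + i)); split; first exact: cyc_shift.
  have [n4 hn _ _ _] := ch.
  by rewrite -addnA addn1 prednK ?(leq_trans _ n4) // addnC hn.
have [n4 _ memH injh eh] := ch1; rewrite !memH.
case=> i lti -> [j ltj ->] [t ltt ->].
rewrite !eh ?(cyc_inj ch1) //; lia.
Qed.

Lemma sector_list u v S : sector_between e H c u v S -> exists m,
  [/\ induced_path e (u :: rcons m v), S = [set x in u :: rcons m v]
    & forall x, (x \in interior u v S) = (x \in m)].
Proof.
case=> -[p [ip lp ->]] sSH; rewrite /path_length cardsE.
have up := ip.1; rewrite (card_uniqP up) /=.
case/lastP: p ip lp up sSH => // m w ip; rewrite last_rcons => wv up _ _ _ _.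
subst w; exists m; split=> // x; move: up; rewrite cons_uniq mem_rcons rcons_uniq !inE mem_rcons !inE !negb_or.
case/and3P=> /andP[uv um] vm um'; have [->|xu] /= := eqVneq x u.
  by rewrite (negPf um).
have [->|xv] //= := eqVneq x v.
by rewrite (negPf vm).
Qed.

(** The interior of a sector is the whole component of any of its vertices, so the sector is
    recovered as that component with its neighbours in H. *)
Lemma mem_sector n h u v S x : cyclic_enum e n h H -> sector_between e H c u v S ->
  x \in interior u v S ->
  x \in nonZ /\ forall y,
    y \in S <-> exists2 w, same_sector x w & (y == w) || e w y && (y \in H).
Proof.
move=> ch sS xS; have [m [im Sm intm]] := sector_list sS.
have [_ /subsetP sSH _ /andP[ecu ecv] nec] := sS.
have /(induced_pathP e x)[um em] := im; rewrite /= size_rcons in em.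
have xm : x \in m by rewrite -intm.
have mH y : y \in m -> y \in nonZ.
  by rewrite -intm => yS; rewrite inE nec // andbT sSH //; case/setDP: yS.
have mS y : y \in m -> y \in S by move=> ym; rewrite Sm !inE mem_rcons inE ym !orbT.
(* The predecessor and successor of [y] on the sector are already its two neighbours in H. *)
have clm y w : y \in m -> w \in H -> e y w -> w \in S.
  move=> ym wH eyw; case/(nthP x): (ym) => i lti yi.
  have nthm k : k <= (size m).+1 -> nth x (u :: rcons m v) k \in S.
    by move=> ltk; rewrite Sm in_set mem_nth //= size_rcons.
  have yi' : y = nth x (u :: rcons m v) i.+1 by rewrite /= nth_rcons lti.
  have i1 : i <= (size m).+1 by exact: leqW (ltnW lti).
  have i2 : i.+2 <= (size m).+1 by exact: lti.
  have i12 : i.+1 <= (size m).+1 by exact: ltnW.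
  have /orP[] : (w == nth x (u :: rcons m v) i) || (w == nth x (u :: rcons m v) i.+2).
  - apply: (cyc_degree2 ch _ _ _ wH _ _ eyw); rewrite ?sSH ?nthm ?mS //.
    + by rewrite yi' em ?eqxx ?orbT.
    + by rewrite yi' em ?eqxx ?orbT.
    + by rewrite nth_uniq //= ?size_rcons // neq_ltn ltnW.
  - by move/eqP->; apply: nthm.
  - by move/eqP->; apply: nthm.
(* The component cannot go past [u] or [v], which are adjacent to [c]. *)
have cmpm w : same_sector x w -> w \in m.
  move=> cxw; apply: (conn_closed _ cxw) (xm) => y z yU zU eyz ym.
  have zS : z \in S by apply: (clm y) => //; move: zU; rewrite inE => /andP[].
  move: zU zS; rewrite Sm !inE mem_rcons inE => /andP[_ ncz].
  by case/or3P=> // /eqP zz; rewrite zz ?ecu ?ecv in ncz.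
have mcmp y z : y \in m -> z \in m -> same_sector y z.
  have /= := induced_path_path im.
  rewrite rcons_path; case: (m) mH => // w m' mH; rewrite /= => /andP[/andP[_ pm] _].
  by apply: (path_conn e_simple pm).
split; first exact: mH.
move=> y; split=> [yS|[w /cmpm wm]]; last first.
  by case/orP=> [/eqP->|/andP[ewy yH]]; [apply: mS | apply: (clm w)].
have m0 : 0 < size m by case: (m) xm.
move: (yS); rewrite Sm !inE mem_rcons inE => /or3P[/eqP yu|/eqP yv|ym]; last first.
- by exists y; rewrite ?eqxx //; apply: mcmp.
- exists (nth x m (size m).-1); first by apply: mcmp; rewrite ?mem_nth ?ltn_predL.
  rewrite sSH // yv andbT; have := em (size m) (size m).+1.
  rewrite /= nth_rcons ltnn eqxx -(prednK m0) /= nth_rcons ltn_predL m0 => ->;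
    by rewrite ?prednK ?eqxx ?orbT.
- exists (nth x m 0); first by apply: mcmp; rewrite ?mem_nth.
  rewrite sSH // yu andbT; have := em 1 0.
  by rewrite /= nth_rcons m0 => ->; rewrite ?orbT.
Qed.

Lemma sector_eq n h u v S u' v' S' x x' : cyclic_enum e n h H ->
  sector_between e H c u v S -> sector_between e H c u' v' S' ->
  x \in interior u v S -> x' \in interior u' v' S' -> same_sector x x' -> S = S'.
Proof.
move=> ch sS sS' xS xS' xx'.
have [_ memS] := mem_sector ch sS xS; have [_ memS'] := mem_sector ch sS' xS'.
have cxx w : same_sector x w = same_sector x' w.
  have x'x : same_sector x' x by rewrite same_sector_sym.
  by apply/idP/idP => cw; [apply: conn_trans x'x cw | apply: conn_trans xx' cw].
apply/setP=> y; apply/idP/idP=> [/memS[w cw yw]|/memS'[w cw yw]].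
  by apply/memS'; exists w; rewrite // -cxx.
by apply/memS; exists w; rewrite // cxx.
Qed.

Lemma sector_seg n h a b : cyclic_enum e n h H -> a < b -> (b - a).+1 < n ->
  e c (h a) -> e c (h b) -> (forall i, a < i < b -> ~~ e c (h i)) ->
  sector_between e H c (h a) (h b) [set x in seg h a (b - a).+1] /\
  path_length [set x in seg h a (b - a).+1] = b - a.
Proof.
move=> ch ab abn eca ecb nec.
have is_ := seg_induced a ch abn.
have pl : path_length [set x in seg h a (b - a).+1] = b - a.
  by rewrite /path_length cardsE (card_uniqP is_.1) size_seg.
split=> //; split; last 1 first.
- move=> x /setDP[]; rewrite inE => /mem_seg[i [iab ->]].
  rewrite !inE => /norP[ia ib]; apply: nec.
  have ia' : i != a by apply: contraNneq ia => ->.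
  have ib' : i != b by apply: contraNneq ib => ->.
  lia.
- have := path_between_seq (h 0) is_; rewrite size_seg => /(_ isT).
  by rewrite !nth_seg //= addn0 subnKC // ltnW.
- by apply/subsetP=> x; rewrite inE => /mem_seg[i [_ ->]]; apply: cyc_in ch.
- by rewrite pl subn_gt0.
- by rewrite eca ecb.
Qed.

(** The sectors are the arcs from 0 to 1, from 1 to [m] and from [m] to [n], the last one ending at
    [h n = h 0]. The bounds on [m] give the last two length at least two. *)
Lemma special_cyc n h (m : nat) : cyclic_enum e n h H -> 3 <= m -> m + 2 <= n ->
  (forall i, i < n -> e c (h i) = [|| i == 0, i == 1 | i == m]) -> special e H c.
Proof.
move=> ch m3 mn ec; have [n4 hn _ injh eh] := ch.
have hn0 : h n = h 0 by rewrite -[n]addn0 hn.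
have [s1 l1] : sector_between e H c (h 0) (h 1) [set x in seg h 0 2] /\
    path_length [set x in seg h 0 2] = 1.
  by apply: (@sector_seg n h 0 1 ch); rewrite ?ec //; lia.
have [s2 l2] : sector_between e H c (h 1) (h m) [set x in seg h 1 (m - 1).+1] /\
    path_length [set x in seg h 1 (m - 1).+1] = m - 1.
  by apply: (@sector_seg n h 1 m ch); rewrite ?ec; try lia; move=> i im; rewrite ec; lia.
have [s3 l3] : sector_between e H c (h m) (h n) [set x in seg h m (n - m).+1] /\
    path_length [set x in seg h m (n - m).+1] = n - m.
  by apply: (@sector_seg n h m n ch); rewrite ?hn0 ?ec; try lia; move=> i im; rewrite ec; lia.
set S1 := [set x in seg h 0 2] in s1 l1; set S2 := [set x in seg h 1 _] in s2 l2.
set S3 := [set x in seg h m _] in s3 l3.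
have hS2 i : 0 < i <= m -> h i \in S2.
  by move=> im; rewrite inE; apply/mem_seg; exists i; split=> //; lia.
have hS3 i : m <= i <= n -> h i \in S3.
  by move=> im; rewrite inE; apply/mem_seg; exists i; split=> //; lia.
exists S1, S2, S3; split; rewrite ?l1 ?l2 ?l3 //; try lia.
  have mS1 : h m \notin S1.
    rewrite inE; apply/negP=> /mem_seg[i [im /injh]]; lia.
  have hS1 : S1 != S2 by apply: contraNneq mS1 => ->; apply: hS2; lia.
  have hS1' : S1 != S3 by apply: contraNneq mS1 => ->; apply: hS3; lia.
  have nS3 : h 2 \notin S3.
    rewrite inE; apply/negP=> /mem_seg[i [im]].
    have [ltin|] := ltnP i n; first by move/injh; lia.
    move=> ni; rewrite (_ : i = n) ?hn0; last lia.
    by move/injh; lia.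
  have hS2' : S2 != S3 by apply: contraNneq nS3 => <-; apply: hS2; lia.
  by rewrite /= !inE negb_or hS1 hS1' hS2'.
move=> S; rewrite !inE; split; last first.
  by case/or3P=> /eqP->; [exists (h 0), (h 1) | exists (h 1), (h m) | exists (h m), (h n)];
    rewrite // hn0.
case=> u [v sS]; have [[|x p] [ip Sp intS]] := sector_list sS.
  have [_ /subsetP sSH _ /andP[ecu ecv] _] := sS.
  have euv : e u v by have /= /andP[] := induced_path_path ip.
  have uS : u \in S by rewrite Sp !inE eqxx.
  have vS : v \in S by rewrite Sp !inE eqxx orbT.
  have [i lti ui] := cyc_at ch (sSH _ uS); have [j ltj vj] := cyc_at ch (sSH _ vS).
  rewrite ui ec // in ecu; rewrite vj ec // in ecv; rewrite ui vj eh // in euv.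
  have ij : (i == 0) && (j == 1) || (i == 1) && (j == 0) by lia.
  suff -> : S = S1 by rewrite eqxx.
  apply/setP=> y; rewrite Sp !inE ui vj.
  by case/orP: ij => /andP[/eqP-> /eqP->]; rewrite // orbC.
have xS : x \in interior u v S by rewrite intS inE eqxx.
have [xU _] := mem_sector ch sS xS.
move: (xU); rewrite inE => /andP[/(cyc_at ch)[i lti xi] ncx].
rewrite xi ec // in ncx.
(* A sector with an interior vertex is determined by it; the position relative to [m] tells which
   arc it is. *)
have [im|mi] := ltnP i m.
  suff -> : S = S2 by rewrite eqxx orbT.
  apply: (sector_eq ch sS s2 xS _ (conn_refl _ _ x)).
  by rewrite xi in_setD in_set2 hS2 ?(cyc_inj ch) //; lia.
suff -> : S = S3 by rewrite eqxx !orbT.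
apply: (sector_eq ch sS s3 xS _ (conn_refl _ _ x)).
by rewrite xi in_setD in_set2 hS3 ?hn0 ?(cyc_inj ch) //; lia.
Qed.

(** * Enumerations adapted to a sector, and the neighbours of [c] away from it *)

Hypothesis c3 : 3 <= #|[set x in H | e c x]|.

Lemma nbrs_not_sub2 x y : exists z, [/\ z \in H, e c z, z != x & z != y].
Proof.
case: (boolP [exists z in H, [&& e c z, z != x & z != y]]) => [/existsP[z]|].
  by case/and4P=> zH ecz zx zy; exists z.
rewrite negb_exists => /forallP nz.
suff /subset_leq_card : [set x in H | e c x] \subset [set x; y].
  by move/(leq_trans c3); rewrite cards2; case: (x != y).
apply/subsetP=> z; rewrite !inE => /andP[zH ecz].
by have := nz z; rewrite zH ecz /= negb_and !negbK.
Qed.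

(** With [x] moved to index 0, its sector runs from the last neighbour [h r] of [c], past the
    origin, to the first one [h l]. The new enumeration therefore starts at [h r] and puts [x] at
    index [n - r]. *)
Lemma frame_exists n h x : cyclic_enum e n h H -> x \in nonZ ->
  exists h' l i, [/\ sector_frame n h' l, 0 < i < l & x = h' i].
Proof.
move=> ch; rewrite inE => /andP[/(cyc_at ch)[k _ ->]] nck.
have {ch} ch' := cyc_shift k ch; set g := fun i => h (k + i) in ch'.
have g0 : h k = g 0 by rewrite /g addn0.
rewrite g0 in nck *; clearbody g; clear h g0; move: g ch' nck => h ch nck {k}.
have [n4 hn memH injh eh] := ch.
have exP : exists i, (i < n) && e c (h i).
  have [z [zH ecz _ _]] := nbrs_not_sub2 c c.
  by have [i lti zi] := cyc_at ch zH; exists i; rewrite lti -zi.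
have bd i : (i < n) && e c (h i) -> i <= n by case/andP=> /ltnW.
case: (ex_minnP exP) => l /andP[ln ecl] minl.
case: (ex_maxnP exP bd) => r /andP[rn ecr] maxr.
(* A second neighbour of [c] forces [l < r], so the ends of the sector are distinct. *)
have [z [zH ecz zl _]] := nbrs_not_sub2 (h l) (h l).
have [i lti zi] := cyc_at ch zH.
have li : l <= i by apply: minl; rewrite lti -zi.
have ir : i <= r by apply: maxr; rewrite lti -zi.
have nli : l != i by apply: contraNneq zl => ->; rewrite zi.
have l0 : l != 0 by apply: contraNneq nck => <-.
have hn0 j : h (n + j) = h j by apply: hn.
exists (fun i => h (r + i)), (n - r + l), (n - r); split; last first.
- by rewrite subnKC ?(ltnW rn) // -[n in RHS]addn0 hn0.
- lia.
split; first exact: cyc_shift.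
- by rewrite addn0.
- by rewrite addnA subnKC ?(ltnW rn) // hn0.
- move=> j jl; have [rj|rj] := ltnP (r + j) n.
    apply/negP=> ecj; have := maxr (r + j); rewrite rj ecj => /(_ isT); lia.
  rewrite -(subnKC rj) hn0; apply/negP=> ecj; have := minl (r + j - n).
  rewrite ecj andbT => ml; have : l <= r + j - n by apply: ml; lia.
  lia.
- lia.
Qed.

Hypothesis cH : c \notin H.
Hypothesis e_prism_free : prism_free e.
Hypothesis W_non_special : ~ special e H c.

(* Otherwise W is special, or the neighbours of c in H form two disjoint edges of
   H and c, as a path of length zero, completes H to a prism. *)
Lemma c_far n h l j : sector_frame n h l -> l < j < n -> ~~ e c (h j) ->
  exists t, [/\ l.+2 <= t, t + 2 <= n & e c (h t)].
Proof.
move=> [ch ec0 ecl nec ln] lj ncj; have [n4 hn memH injh eh] := ch.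
have [[t /and3P[]]|nt] := altP (@existsP _ (fun t : 'I_n => [&& l.+2 <= t, t + 2 <= n & e c (h t)])).
  by move=> *; exists t.
exfalso; have {}nt t : l.+2 <= t -> t + 2 <= n -> ~~ e c (h t).
  move=> lt tn; apply/negP=> ect; case/existsP: nt.
  have ltn : t < n by lia.
  by exists (Ordinal ltn); rewrite /= lt tn ect.
(* Besides [h 0] and [h l], only [h l.+1] and [h n.-1] can be adjacent to [c], which leaves four
   cases. *)
have ecE i : i < n -> e c (h i) =
  [|| i == 0, i == l, (i == l.+1) && e c (h l.+1) | (i.+1 == n) && e c (h n.-1)].
  move=> lti; have [->|i0] := eqVneq i 0; first by rewrite ec0.
  have [->|il] := eqVneq i l; first by rewrite ecl.
  have [->|il1] := eqVneq i l.+1.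
    by case: eqP => [<-|_]; rewrite ?orbb ?orbF.
  have [ein|nin] := eqVneq i.+1 n; first by rewrite -ein.
  rewrite /=; apply/negbTE; have [ltil|geil] := ltnP i l; first by apply: nec; lia.
  by apply: nt; lia.
(* As [h j] is not adjacent to [c], it differs from each new neighbour; this provides the room
   between [h l] and [h n] that each case requires. *)
have nl1 : j = l.+1 -> e c (h l.+1) = false by move=> jl; apply/negbTE; rewrite -jl.
have nn1 : j = n.-1 -> e c (h n.-1) = false by move=> jl; apply/negbTE; rewrite -jl.
have [z [zH ecz z0 zl]] := nbrs_not_sub2 (h 0) (h l).
have [i lti zi] := cyc_at ch zH; rewrite zi !(cyc_inj ch) // in z0 zl; try lia.
rewrite zi ecE // (negPf z0) (negPf zl) /= in ecz.
case: (boolP (e c (h l.+1))) (nl1) ecz ecE => ecl1 nl1';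
  case: (boolP (e c (h n.-1))) (nn1) => ecn1 nn1' ecz ecE.
- have ind_c : induced_path e [:: c].
    by apply/(induced_pathP e c); split=> // [[|?]] [|?] //=; rewrite adjxx.
  have [||||X] := @prism_cyc _ e e_simple n h H c [::] l ch _ _ ind_c.
  + lia.
  + have : j <> l.+1 by move=> jl; have := nl1' jl.
    have : j <> n.-1 by move=> jl; have := nn1' jl.
    lia.
  + by move=> r; rewrite inE => /eqP->.
  + by move=> r k; rewrite inE => /eqP-> ltk; rewrite eqxx /= ecE // !andbT; lia.
  exact: e_prism_free.
(* Counted from [h l], the neighbours [h l], [h l.+1], [h 0] have indices 0, 1 and [n - l]. *)
- apply: W_non_special; apply: (@special_cyc n (fun i => h (l + i)) (n - l)).
  + exact: cyc_shift.
  + have : j <> l.+1 by move=> jl; have := nl1' jl.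
    lia.
  + lia.
  + move=> k ltk; have [kn|kn] := ltnP (l + k) n; first by rewrite ecE //; lia.
    by rewrite -(subnKC kn) hn ecE; lia.
(* Counted from [h n.-1], the neighbours [h n.-1], [h 0], [h l] have indices 0, 1 and [l.+1]. *)
- apply: W_non_special; apply: (@special_cyc n (fun i => h (n.-1 + i)) l.+1).
  + exact: cyc_shift.
  + lia.
  + have : j <> n.-1 by move=> jl; have := nn1' jl.
    lia.
  + move=> k ltk; have [kn|kn] := ltnP (n.-1 + k) n; first by rewrite ecE //; lia.
    by rewrite -(subnKC kn) hn ecE; lia.
- by move: ecz; rewrite !andbF.
Qed.

End Wheels.


(** * Paths joining two sectors *)

Section Links.

Variables (T : finType) (e : rel T) (H : {set T}) (c : T).
Hypothesis e_simple : simple_graph e.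
Implicit Types (x y z u v w r : T) (p s : seq T) (A B S : {set T}) (h : nat -> T).

Let adjC := adjC e_simple.
Let adjxx := adjxx e_simple.

Notation nonZ := (nonZ e H c).
Notation same_sector := (same_sector e H c).

(** The vertices outside both H and N[Z(W)], as [outside_compl] confirms, spelled out through
    adjacency. *)
Definition outside := [set r | [&& r \notin H, r != c, ~~ e c r &
  [forall w in H, e r w ==> ~~ e c w]]].

Lemma outsideP r : r \in outside ->
  [/\ r \notin H, r != c, ~~ e c r & forall w, w \in H -> e r w -> w \in nonZ].
Proof.
rewrite inE => /and4P[rH rc ecr /forall_inP rw]; split=> // w wH erw.
by rewrite inE wH; apply: (implyP (rw w wH)).
Qed.

Lemma outside_compl : ~: closed_nbhd e (wheelZ e H c) :\: H = outside.
Proof.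
apply/setP=> r; rewrite !inE; case: (r \in H) => //=.
have [->|rc] //= := eqVneq r c.
apply/idP/andP=> [/existsP nr|[ncr /forall_inP nr]].
  split; first by apply/negP=> ecr; case: nr; exists c; rewrite !inE eqxx adjC.
  apply/forall_inP=> w wH; apply/implyP=> erw; apply/negP=> ecw; case: nr; exists w.
  by rewrite !inE wH ecw orbT.
apply/existsP=> -[w]; rewrite !inE => /andP[/orP[/eqP->|/andP[wH ecw]] erw].
  by rewrite adjC erw in ncr.
by move/implyP: (nr w wH) => /(_ erw); rewrite ecw.
Qed.

(* The last clause is what minimality of the path gives; the case q = [::] is
   apart because a single vertex may attach to any number of sectors. *)
Definition link x y q0 q :=
  [/\ induced_path e (q0 :: q), forall r, r \in q0 :: q -> r \in outside,
      [&& e q0 x, e (last q0 q) y, x \in nonZ & y \in nonZ], ~~ same_sector x y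
    & forall r w, r \in q0 :: q -> w \in H -> e r w ->
      [\/ q = [::], r = q0 /\ same_sector x w | r = last q0 q /\ same_sector y w]].

(** A set [A] minimal under inclusion among those joining two sectors replaces a shortest path: any
    piece of a path inside [A] that still joins two sectors is all of [A]. *)
Lemma link_minimal B q0 q1 x y :
  B \subset outside -> q0 \in B -> conn e B q0 q1 -> e q0 x -> e q1 y ->
  x \in nonZ -> y \in nonZ -> ~~ same_sector x y ->
  exists x y q0 q, link x y q0 q.
Proof.
move=> sB q0B c01 e0x e1y xU yU ncxy.
pose P (B : {set T}) := [exists q0 in B, [exists q1, conn e B q0 q1 &&
  [exists x in nonZ, [exists y in nonZ, [&& e q0 x, e q1 y & ~~ same_sector x y]]]]].
have PI (A : {set T}) r0 r1 z w : r0 \in A -> conn e A r0 r1 -> e r0 z -> e r1 w ->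
    z \in nonZ -> w \in nonZ -> ~~ same_sector z w -> P A.
  move=> r0A c01' ez ew zU wU nc.
  apply/exists_inP; exists r0 => //; apply/existsP; exists r1; rewrite c01' /=.
  by apply/exists_inP; exists z => //; apply/exists_inP; exists w; rewrite // ez ew.
have /minset_exists[A /minsetP[PA minA] sA] : P B by apply: PI e0x e1y xU yU ncxy.
case/exists_inP: PA {B sB q0 q1 x y q0B c01 e0x e1y xU yU ncxy PI minA sA} (subset_trans sA sB) (PI) (minA).
move=> q0 q0A /existsP[q1 /andP[c01 /exists_inP[x xU /exists_inP[y yU /and3P[e0x e1y ncxy]]]]].
move=> sA PI minA.
have [q [iq lq qA]] := conn_induced_path e_simple c01 q0A.
have uq := iq.1; have pq := induced_path_path iq.
(* If [w] is not in the sector of [x], the piece from [q0] to [r] already joins two sectors, so by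
   minimality [r] is the last vertex. The piece from [r] to [q1] is treated alike. *)
have F r w : r \in q0 :: q -> w \in H -> e r w ->
    (~~ same_sector x w -> r = q1) /\ (~~ same_sector w y -> r = q0).
  move=> rq wH erw; have rA := qA _ rq.
  have wU : w \in nonZ by have [_ _ _] := outsideP (subsetP sA _ rA); apply.
  case/splitPl: rq uq pq lq qA => p1 p2 lp uq pq lq qA.
  have [pp1 pp2] : path e q0 p1 /\ path e r p2 by apply/andP; move: pq; rewrite cat_path lp.
  rewrite last_cat lp in lq; split=> nc.
  - have sA1 : forall u, u \in q0 :: p1 -> u \in A.
      by move=> u up; apply: qA; rewrite -cat_cons mem_cat up.
    have : [set u in q0 :: p1] = A.
      apply: minA; last by apply/subsetP=> u; rewrite inE; apply: sA1.
      apply: (PI _ q0 r x w) => //; first by rewrite inE mem_head.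
      apply: (path_conn e_simple pp1); [|exact: mem_head|by rewrite -lp mem_last].
      by move=> u up; rewrite in_set.
    move/setP/(_ q1); rewrite in_set -lq.
    have -> : last r p2 \in A by rewrite lq (conn_in c01).
    case: p2 {qA pp2 lq pq} uq => [_ _ //|u p2]; rewrite -cat_cons cat_uniq.
    case/and3P=> _ /hasPn n12 _ l12; have /negP[] := n12 (last u p2) (mem_last _ _).
    exact: l12.
  - have sA2 : forall u, u \in r :: p2 -> u \in A.
      move=> u; rewrite inE => /predU1P[->|up]; first exact: rA.
      by apply: qA; rewrite -cat_cons mem_cat up orbT.
    have : [set u in r :: p2] = A.
      apply: minA; last by apply/subsetP=> u; rewrite inE; apply: sA2.
      apply: (PI _ r q1 w y) => //; first by rewrite inE mem_head.
      apply: (path_conn e_simple pp2); [|exact: mem_head|by rewrite -lq mem_last].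
      by move=> u up; rewrite in_set.
    move/setP/(_ q0); rewrite in_set inE q0A => /orP[/eqP->//|q02].
    by move: uq; rewrite /= mem_cat q02 orbT.
exists x, y, q0, q; split=> //.
- by move=> r /qA; apply: (subsetP sA).
- by rewrite e0x lq e1y xU yU.
move=> r w rq wH erw; rewrite lq; have [F1 F2] := F r w rq wH erw.
have [cxw|ncxw] := boolP (same_sector x w).
  constructor 2; split=> //; apply: F2; apply: contra ncxy => cwy.
  exact: conn_trans cxw cwy.
have [cwy|ncwy] := boolP (same_sector w y).
  by constructor 3; split; [apply: F1 | rewrite (same_sector_sym _ _ e_simple)].
(* An attachment in a third sector makes its vertex both first and last on the path. *)
constructor 1; have := F1 ncxw; rewrite (F2 ncwy) => q01.
case: q uq lq {iq qA rq F pq} => // u q /= /andP[q0q _] lq.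
by rewrite q01 -lq mem_last in q0q.
Qed.

(** If no component of [outside] saw two sectors, the sector of [a] with the components of [outside]
    attached to it would be closed under the edges avoiding N[Z(W)], and [b] would not be
    reached. *)
Lemma link_exists n h a b : cyclic_enum e n h H -> a \in H -> b \in H ->
  b \notin closed_nbhd e (wheelZ e H c) ->
  ~~ same_sector a b -> conn e (~: closed_nbhd e (wheelZ e H c)) a b ->
  exists x y q0 q, link x y q0 q.
Proof.
set N := closed_nbhd _ _ => ch aH bH bN ncab cab.
have HU w : w \in H -> w \notin N -> w \in nonZ.
  by move=> wH; rewrite !inE wH /= => /norP[/norP[]].
pose K := [set v in H | same_sector a v] :|:
  [set v in outside | [exists r, conn e outside v r && [exists x in nonZ, e r x && same_sector a x]]].
have [[x [y [q0 [q1 [q0B c01 [e0x e1y xU yU ncxy]]]]]]|nlink] :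
   (exists x y q0 q1, [/\ q0 \in outside, conn e outside q0 q1 &
      [/\ e q0 x, e q1 y, x \in nonZ, y \in nonZ & ~~ same_sector x y]]) \/
   (forall x y q0 q1, q0 \in outside -> conn e outside q0 q1 -> e q0 x -> e q1 y ->
      x \in nonZ -> y \in nonZ -> same_sector x y).
  case: (boolP [exists x, [exists y, [exists q0, [exists q1, [&& q0 \in outside,
     conn e outside q0 q1, e q0 x, e q1 y, x \in nonZ, y \in nonZ & ~~ same_sector x y]]]]]).
    case/existsP=> x /existsP[y /existsP[q0 /existsP[q1]]].
    by move=> /and5P[? ? ? ? /and3P[? ? ?]]; left; exists x, y, q0, q1.
  move=> nex; right=> x y q0 q1 q0o c01 e0x e1y xU yU; apply/negPn/negP=> nc.
  case/negP: nex; apply/existsP; exists x; apply/existsP; exists y.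
  apply/existsP; exists q0; apply/existsP; exists q1.
  by rewrite q0o c01 e0x e1y xU yU.
- by apply: (link_minimal (subxx _) q0B c01 e0x e1y).
have bK : b \in K.
  apply: (conn_closed _ cab); last by rewrite in_setU in_set aH; apply/orP; left; apply: conn_refl.
  move=> u v; rewrite ![_ \in ~: _]in_setC => uN vN euv.
  have outv w : w \notin N -> w \notin H -> w \in outside.
    by move=> wN wH; rewrite -outside_compl in_setD wH in_setC.
  rewrite in_setU [u \in [set _ in H | _]]in_set [u \in [set _ in outside | _]]in_set.
  rewrite in_setU [v \in [set _ in H | _]]in_set [v \in [set _ in outside | _]]in_set.
  have [vH|vH] /= := boolP (v \in H); case/orP=> /andP[].
  - move=> uH cau; apply/orP; left; apply: conn_trans cau _.
    by apply: conn1; rewrite ?HU.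
  (* Re-entering H is the only case that uses the absence of a joining path: [v] must lie in the
     sector already seen. *)
  - move=> uo /existsP[r /andP[cur /exists_inP[x xU /andP[erx cax]]]].
    apply/orP; left; apply: conn_trans cax _; apply: (nlink x v r u) => //.
    + exact: conn_in cur uo.
    + by rewrite conn_sym.
    + exact: HU.
  - move=> uH cau; rewrite outv //=; apply/existsP; exists v; rewrite conn_refl.
    by apply/exists_inP; exists u; rewrite ?HU // adjC euv.
  - move=> uo /existsP[r /andP[cur rx]]; rewrite outv //=; apply/existsP; exists r.
    rewrite rx andbT; apply: (conn_trans _ cur); apply: conn1 => //; first exact: outv.
    by rewrite adjC.
move: bK; rewrite in_setU [b \in [set _ in H | _]]in_set (negPf ncab) andbF /=.
by rewrite in_set => /andP[/outsideP[]]; rewrite bH.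
Qed.

Lemma last_rev_belast (q0 : T) q : last (last q0 q) (rev (belast q0 q)) = q0.
Proof. by case: q => //= y q; rewrite rev_cons last_rcons. Qed.

Lemma link_rev x y q0 q : link x y q0 q -> link y x (last q0 q) (rev (belast q0 q)).
Proof.
have eqr : last q0 q :: rev (belast q0 q) = rev (q0 :: q) by rewrite (lastI q0 q) rev_rcons.
case=> iq qo /and4P[e0 e1 xU yU] nc att; split.
- by rewrite eqr; apply: induced_path_rev.
- by move=> r; rewrite eqr mem_rev; apply: qo.
- by rewrite last_rev_belast e0 e1 xU yU.
- by rewrite same_sector_sym.
move=> r w; rewrite eqr mem_rev last_rev_belast => rq wH erw.
have [q0'|?|?] := att r w rq wH erw; [|by constructor 3|by constructor 2].
by constructor 1; rewrite q0'.
Qed.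

(** For a single vertex the last clause of [link] is void, so the attachments can be chosen anew in
    any two sectors it sees. *)
Lemma link_single x y q0 x' y' : link x y q0 [::] ->
  x' \in H -> y' \in H -> e q0 x' -> e q0 y' -> ~~ same_sector x' y' -> link x' y' q0 [::].
Proof.
move=> [iq qo _ _ _] xH yH ex ey nc.
have [_ _ _ oU] := outsideP (qo q0 (mem_head _ _)).
split=> //; first by rewrite /= ex ey !oU.
by move=> r w _ _ _; constructor 1.
Qed.

End Links.


(** * Attachments of the path to the hole *)

Section Hits.

Variables (T : finType) (e : rel T) (H : {set T}) (c : T).
Hypothesis e_simple : simple_graph e.
Hypothesis c3 : 3 <= #|[set x in H | e c x]|.
Hypothesis cH : c \notin H.
Hypothesis e_theta_free : theta_free e.
Hypothesis e_prism_free : prism_free e.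
Hypothesis W_non_special : ~ special e H c.
Implicit Types (x y z u v w r : T) (p s : seq T) (A B S : {set T}) (h : nat -> T).

Let adjC := adjC e_simple.
Let adjxx := adjxx e_simple.

Notation nonZ := (nonZ e H c).
Notation same_sector := (same_sector e H c).
Notation outside := (outside e H c).
Notation link := (link e H c).

(* The preprocessing of lia does not terminate in reasonable time in the presence
   of many boolean hypotheses about the graph. *)
Ltac graph_lia := repeat match goal with
  | Hx : context [e] |- _ => clear Hx
  | Hx : context [H] |- _ => clear Hx
  end; lia.

(** [A] carries the interior of one path of a theta with ends [x] and [y]; [u] and [v] are the
    points of contact. *)
Definition leg x y A u v :=
  [/\ x \notin A, y \notin A, u \in A, e x u /\ e y v & conn e A u v].

Lemma three_legs_absurd x y A1 A2 A3 u1 v1 u2 v2 u3 v3 : x != y -> ~~ e x y ->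
  leg x y A1 u1 v1 -> leg x y A2 u2 v2 -> leg x y A3 u3 v3 ->
  far e A1 A2 -> far e A1 A3 -> far e A2 A3 -> False.
Proof.
move=> xy nxy L1 L2 L3 F12 F13 F23.
have [|X] := @theta_of_conn _ e e_simple x y [:: A1; A2; A3] [:: u1; u2; u3]
   [:: v1; v2; v3] xy nxy _ F12 F13 F23; last exact: e_theta_free.
by case=> [|[|[|//]]] _; [case: L1 | case: L2 | case: L3] => -> -> ? [? ?] ?; split.
Qed.

(** Given by its end indices, both included, whereas [seg] takes a start and a length; empty when
    [b < a]. *)
Definition ivl h a b := [set x in seg h a (b.+1 - a)].

Lemma mem_ivl h a b x : x \in ivl h a b <-> exists2 i, a <= i <= b & x = h i.
Proof.
rewrite in_set; split=> [/mem_seg[i [iab ->]]|[i iab ->]].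
  by exists i => //; graph_lia.
by apply/mem_seg; exists i; split=> //; graph_lia.
Qed.

Lemma ivl_mem h a b i : a <= i <= b -> h i \in ivl h a b.
Proof. by move=> iab; apply/mem_ivl; exists i. Qed.

Lemma ivl_conn n h a b i j : cyclic_enum e n h H -> a <= i <= b -> a <= j <= b ->
  conn e (ivl h a b) (h i) (h j).
Proof. by move=> ch; apply: (conn_seg e_simple ch) => k; apply: ivl_mem. Qed.

Lemma ivl_sub n h a b x : cyclic_enum e n h H -> x \in ivl h a b -> x \in H.
Proof. by move=> ch /mem_ivl[i _ ->]; apply: cyc_in ch. Qed.

Lemma ivl_notin n h a b i : cyclic_enum e n h H -> i < n -> b < n -> (i < a) || (b < i) ->
  h i \notin ivl h a b.
Proof.
move=> ch ltin ltbn iab; apply/negP=> /mem_ivl[j jab /eqP].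
rewrite (cyc_inj ch) //; graph_lia.
Qed.

(** The last hypothesis excludes the wrap-around edge between [h 0] and [h n.-1]. *)
Lemma far_ivl n h a b a' b' : cyclic_enum e n h H -> b.+1 < a' -> b' < n ->
  (0 < a) || (b'.+1 < n) -> far e (ivl h a b) (ivl h a' b').
Proof.
move=> ch ba' b'n ab; have [n4 _ _ injh eh] := ch; split.
  apply/pred0P=> x /=; apply/negP=> /andP[/mem_ivl[i iab ->] /mem_ivl[j jab]].
  move/injh; graph_lia.
move=> x y /mem_ivl[i iab ->] /mem_ivl[j jab ->]; rewrite eh; graph_lia.
Qed.

Lemma far_setU A B S : far e A B -> far e A S -> far e A (B :|: S).
Proof.
move=> [dB aB] [dS aS]; split.
  by move: dB dS; rewrite -!setI_eq0 setIUr => /eqP-> /eqP->; rewrite setU0.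
by move=> x y xA; rewrite inE => /orP[]; [apply: aB | apply: aS].
Qed.

Lemma far_outside n h a b s : cyclic_enum e n h H -> (forall r, r \in s -> r \in outside) ->
  (forall r i, r \in s -> a <= i <= b -> ~~ e r (h i)) ->
  far e (ivl h a b) [set r in s].
Proof.
move=> ch so sn; split.
  apply/pred0P=> x /=; apply/negP=> /andP[/(ivl_sub ch) xH]; rewrite in_set => /so/outsideP[].
  by rewrite xH.
by move=> x r /mem_ivl[i iab ->]; rewrite in_set adjC => rs; apply: sn.
Qed.

Lemma outside_notin_ivl n h a b r : cyclic_enum e n h H -> r \notin H -> r \notin ivl h a b.
Proof. by move=> ch; apply: contra; apply: ivl_sub ch. Qed.

(** The attachment of [r] to the sector of [x] is exactly one edge of H, so that [r] completes it to
    a triangle of a prism. *)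
Definition pair_nbrs r x := exists z z',
  [/\ e z z', same_sector x z /\ same_sector x z', e r z /\ e r z', z \in H /\ z' \in H
    & forall w, w \in H -> same_sector x w -> e r w -> w = z \/ w = z'].

(* Otherwise there is a theta between c and either the unique neighbour h i1 of q0
   in the sector, or q0 itself when the extreme neighbours h i1 and h i2 are not
   adjacent; the third path goes through q and h l.+2, ..., h (n - 2). *)
Lemma hits_beyond n h l i y q0 q :
  sector_frame e H c n h l -> 0 < i < l -> link (h i) y q0 q -> ~ pair_nbrs q0 (h i) ->
  forall j, l < j < n -> e (last q0 q) (h j) -> j = l.+1 \/ j.+1 = n.
Proof.
move=> fr il lk npair j lj ej.
have [jl1|jl1] := eqVneq j l.+1; first by left.
have [jn1|jn1] := eqVneq j.+1 n; first by right.
exfalso; have [ch ec0 ecl nec ln] := fr; have [n4 hn memH injh eh] := ch.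
have [iq qo /and4P[e0x _ xU yU] nc att] := lk.
have lastQ : last q0 q \in q0 :: q by apply: mem_last.
have q0Q : q0 \in q0 :: q by apply: mem_head.
have hH k : h k \in H by apply: cyc_in ch.
have jU : h j \in nonZ by have [_ _ _] := outsideP (qo _ lastQ); apply.
have ncj : ~~ e c (h j) by move: jU; rewrite inE => /andP[].
(* Through [h t] the third path of the theta will reach [c]. *)
have [t [lt tn ect]] := c_far e_simple c3 cH e_prism_free W_non_special fr lj ncj.
have ex1 : exists k, [&& 0 < k, k < l & e q0 (h k)].
  by exists i; rewrite e0x andbT.
have bd k : [&& 0 < k, k < l & e q0 (h k)] -> k <= l by case/and3P=> _ /ltnW.
case: (ex_minnP ex1) => i1 /and3P[i10 i1l ei1] mini1.
case: (ex_maxnP ex1 bd) => i2 /and3P[i20 i2l ei2] maxi2.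
have Qatt r k : r \in q0 :: q -> k <= l -> e r (h k) -> r = q0 /\ i1 <= k <= i2.
  move=> rQ kl erk; have [_ _ _ oU] := outsideP (qo _ rQ).
  have nck : ~~ e c (h k) by move: (oU _ (hH k) erk); rewrite inE => /andP[].
  have k0 : k != 0 by apply: contraNneq nck => ->.
  have kl' : k != l by apply: contraNneq nck => ->.
  have kl0 : 0 < k < l by graph_lia.
  suff rq0 : r = q0.
    split=> //; rewrite mini1 ?maxi2 //; apply/and3P; split; rewrite -?rq0 //; graph_lia.
  have [q_nil|[]//|[_ cyk]] := att _ _ rQ (hH k) erk.
    by move: rQ; rewrite q_nil inE => /eqP.
  case/negP: nc; rewrite (same_sector_sym _ _ e_simple); apply: conn_trans cyk _.
  exact: frame_same_sector fr kl0 il.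
(* [D] omits [h l.+1] and [h n.-1], hence is anticomplete to the arc from [h 0] to [h l]; it
   contains [h j] because [j] avoids these two positions. *)
pose D := ivl h l.+2 (n - 2).
have ln3 : l.+2 <= j <= n - 2 by graph_lia.
have tD : l.+2 <= t <= n - 2 by graph_lia.
have farD a b : b <= l -> far e (ivl h a b) D.
  by move=> bl; apply: (far_ivl ch); graph_lia.
have cD a b : c \notin ivl h a b by apply: outside_notin_ivl ch cH.
have cQ : c \notin q0 :: q.
  by apply/negP=> /qo/outsideP[_]; rewrite eqxx.
have i12 : i1 <= i2 by apply: maxi2; rewrite i10 i1l.
have [ei12|ni12] := eqVneq i1 i2.
- subst i2.
  have conn3 : conn e ([set r in q0 :: q] :|: D) q0 (h t).
    apply: (@conn_trans _ _ _ (last q0 q)).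
      apply: (path_conn e_simple (induced_path_path iq)) => // r rQ.
      by rewrite in_setU [_ \in [set _ in _]]in_set rQ.
    apply: (@conn_trans _ _ _ (h j)).
      apply: conn1 => //; last by rewrite in_setU ivl_mem ?orbT.
      by rewrite in_setU [_ \in [set _ in _]]in_set lastQ.
    by apply: conn_sub (ivl_conn ch ln3 tD); apply: subsetUr.
  apply: (@three_legs_absurd (h i1) c (ivl h 0 i1.-1) (ivl h i1.+1 l) ([set r in q0 :: q] :|: D)
     (h i1.-1) (h 0) (h i1.+1) (h l) q0 (h t)).
  + by apply: contraNneq cH => <-.
  + by rewrite adjC nec //; graph_lia.
  + split; rewrite ?cD ?(ivl_notin ch) ?ivl_mem ?eh //; try graph_lia.
      by rewrite ec0; split=> //; graph_lia.
    by apply: (ivl_conn ch); graph_lia.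
  + split; rewrite ?cD ?(ivl_notin ch) ?ivl_mem ?eh //; try graph_lia.
      by rewrite ecl; split=> //; graph_lia.
    by apply: (ivl_conn ch); graph_lia.
  + split=> //; last by rewrite adjC ei1.
    * rewrite in_setU negb_or (ivl_notin ch) ?andbT //; try graph_lia.
      rewrite in_set; apply/negP=> /qo/outsideP[]; by rewrite hH.
    * by rewrite in_setU negb_or cD andbT in_set.
    * by rewrite in_setU in_set mem_head.
  + by apply: (far_ivl ch); graph_lia.
  + apply: far_setU; last by apply: farD; graph_lia.
    apply: (far_outside ch) => // r k rQ ki; apply/negP=> /(Qatt _ _ rQ)[]; graph_lia.
  + apply: far_setU; last by apply: farD; graph_lia.
    apply: (far_outside ch) => // r k rQ ki; apply/negP=> /(Qatt _ _ rQ)[]; graph_lia.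
(* Adjacent extreme neighbours would be the whole attachment, against [npair]. *)
- have i12' : i1.+1 < i2.
    suff : i2 != i1.+1 by graph_lia.
    apply/eqP=> ei2'; case: npair; exists (h i1), (h i2); split.
    + by rewrite ei2'; apply: cyc_adjS ch.
    + by split; apply: (frame_same_sector e_simple fr); graph_lia.
    + by [].
    + by [].
    + move=> w wH cw ew; have [k kl wk] := frame_same_sector_out fr il cw.
      have [||_ ik] := Qatt q0 k q0Q; [graph_lia|by rewrite -wk|].
      have [ek|ek] : k = i1 \/ k = i2 by graph_lia.
        by left; rewrite wk ek.
      by right; rewrite wk ek.
  have q0q : q0 \notin q by have := iq.1 => /= /andP[].
  (* [u] follows [q0] on the third path: it is the first vertex of [q], or [h j] when [q] is
     empty. *)
  have [u [uA eu cu]] : exists u, [/\ u \in [set r in q] :|: D, e q0 u &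
      conn e ([set r in q] :|: D) u (h t)].
    have cjt : conn e ([set r in q] :|: D) (h j) (h t).
      by apply: conn_sub (ivl_conn ch ln3 tD); apply: subsetUr.
    have jA : h j \in [set r in q] :|: D by rewrite in_setU ivl_mem ?orbT.
    case: (q) iq ej jA cjt => [|q1 q'] iq' ej' jA cjt; first by exists (h j).
    have /= /andP[e01 pq'] := induced_path_path iq'.
    have q1A : forall r, r \in q1 :: q' -> r \in [set r in q1 :: q'] :|: D.
      by move=> r rq; rewrite in_setU in_set rq.
    exists q1; split=> //; first by rewrite q1A // mem_head.
    apply: conn_trans cjt; apply: (@conn_trans _ _ _ (last q1 q')).
      by apply: (path_conn e_simple pq') => //; rewrite ?mem_head ?mem_last.
    by apply: conn1 => //; rewrite q1A // mem_last.
  have qo' r : r \in q -> r \in outside by move=> rq; apply: qo; rewrite inE rq orbT.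
  have nq r k : r \in q -> k <= l -> ~~ e r (h k).
    move=> rq kl; apply/negP=> erk.
    have rQ : r \in q0 :: q by rewrite inE rq orbT.
    by have [rq0 _] := Qatt r k rQ kl erk; rewrite -rq0 rq in q0q.
  have [q0H q0c ncq0 _] := outsideP (qo _ q0Q).
  apply: (@three_legs_absurd q0 c (ivl h 0 i1) (ivl h i2 l) ([set r in q] :|: D)
     (h i1) (h 0) (h i2) (h l) u (h t)).
  + by [].
  + by rewrite adjC.
  + split; rewrite ?cD ?(outside_notin_ivl _ _ ch) ?ivl_mem //; try graph_lia.
    by apply: (ivl_conn ch); graph_lia.
  + split; rewrite ?cD ?(outside_notin_ivl _ _ ch) ?ivl_mem //; try graph_lia.
    by apply: (ivl_conn ch); graph_lia.
  + split=> //.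
    * by rewrite in_setU negb_or (outside_notin_ivl _ _ ch) ?andbT // in_set.
    * rewrite in_setU negb_or cD andbT in_set; apply: contra cQ => cq.
      by rewrite inE cq orbT.
  + by apply: (far_ivl ch); graph_lia.
  + apply: far_setU; last by apply: farD; graph_lia.
    by apply: (far_outside ch) => // r k rq ki; apply: nq => //; graph_lia.
  + apply: far_setU; last by apply: farD; graph_lia.
    by apply: (far_outside ch) => // r k rq ki; apply: nq => //; graph_lia.
Qed.

Lemma hits_pos n h l i y q0 q :
  sector_frame e H c n h l -> 0 < i < l -> link (h i) y q0 q -> ~ pair_nbrs q0 (h i) ->
  forall w, w \in H -> e (last q0 q) w -> ~~ same_sector (h i) w ->
  exists k, [/\ l < k < n, w = h k, ~~ e c (h k) & k = l.+1 \/ k.+1 = n].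
Proof.
move=> fr il lk npair w wH ew ncw.
have [ch ec0 ecl nec ln] := fr; have [_ qo _ _ _] := lk.
have [_ _ _ oU] := outsideP (qo _ (mem_last q0 q)).
have [k ltk wk] := cyc_at ch wH.
have kU := oU _ wH ew; have nck : ~~ e c (h k) by move: kU; rewrite wk inE => /andP[].
have k0 : k != 0 by apply: contraNneq nck => ->.
have kl : k != l by apply: contraNneq nck => ->.
have lk' : l < k.
  have [//|kl'] := ltnP l k; case/negP: ncw; rewrite wk.
  by apply: (frame_same_sector e_simple fr il); graph_lia.
exists k; split=> //; first by rewrite lk'.
by apply: (hits_beyond fr il lk npair); rewrite ?lk' // -wk.
Qed.

(** Along H, a single vertex [u], a neighbour of [c], lies between [w] and the sector of [x]. *)
Definition adjacent_gap x w := exists u x',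
  [/\ u \in H, e c u, e u w, x' \in H & e u x' /\ same_sector x x'].

Variables (n : nat) (g : nat -> T).
Hypothesis cyc_g : cyclic_enum e n g H.

Let same_sectorC := same_sector_sym H c e_simple.

(** Outside the sector of [x], only [h l.+1] and [h n.-1] are left for the far end of the path. Each
    is one neighbour of [c] away from that sector, and the neighbour [h t] of [c] keeps them in
    different sectors. *)
Lemma hits_far x y q0 q : link x y q0 q -> ~ pair_nbrs q0 x ->
  (forall w, w \in H -> e (last q0 q) w -> ~~ same_sector x w -> adjacent_gap x w) /\
  (forall w w', w \in H -> w' \in H -> e (last q0 q) w -> e (last q0 q) w' ->
      ~~ same_sector x w -> same_sector w w' -> w = w').
Proof.
move=> lk npair; have [iq qo /and4P[e0x e1y xU yU] nc att] := lk.
have [h [l [i [fr il xi]]]] := frame_exists c3 cyc_g xU.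
rewrite xi in lk npair nc *.
have [ch ec0 ecl nec ln] := fr; have [n4 hn memH injh eh] := ch.
have pos := hits_pos fr il lk npair.
have yH : y \in H by move: yU; rewrite inE => /andP[].
have [jy [jyl _ ncjy _]] := pos y yH e1y nc.
have [t [lt tn ect]] := c_far e_simple c3 cH e_prism_free W_non_special fr jyl ncjy.
have hH k : h k \in H by apply: cyc_in ch.
split.
- move=> w wH ew ncw; have [k [kl -> _ [kl1|kn]]] := pos w wH ew ncw.
    exists (h l), (h l.-1); split; rewrite ?hH ?eh //; try graph_lia.
    by split; [graph_lia | apply: (frame_same_sector e_simple fr il); graph_lia].
  exists (h 0), (h 1); split; rewrite ?hH ?eh //; try graph_lia.
  by split; [graph_lia | apply: (frame_same_sector e_simple fr il); graph_lia].
- move=> w w' wH w'H ew ew' ncw cww'.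
  have ncw' : ~~ same_sector (h i) w'.
    by apply: contra ncw => cw'; apply: same_sector_trans cw' _; rewrite same_sectorC.
  have [k [kl wk nck kk]] := pos w wH ew ncw.
  have [k' [kl' wk' nck' kk']] := pos w' w'H ew' ncw'.
  have tn' : t < n by graph_lia.
  rewrite wk wk'; congr h; case: kk => kk; case: kk' => kk'; try graph_lia; exfalso.
    have lkt : l < k < t by graph_lia.
    rewrite wk wk' in cww'.
    have [j jlt] := same_sector_between ch tn' ecl ect lkt cww'.
    by move/injh; graph_lia.
  have lkt : l < k' < t by graph_lia.
  rewrite wk wk' same_sectorC in cww'.
  have [j jlt] := same_sector_between ch tn' ecl ect lkt cww'.
  by move/injh; graph_lia.
Qed.

(** The second part of [hits_far] gives uniqueness at [y]. The far end is then no pair either, so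
    the reversed link gives uniqueness at [x]. *)
Lemma link_nonpair_single x y q0 q : link x y q0 q -> ~ pair_nbrs q0 x ->
  (forall w, w \in H -> e q0 w -> same_sector x w -> w = x) /\
  (forall w, w \in H -> e (last q0 q) w -> same_sector y w -> w = y).
Proof.
move=> lk np; have single_last x' y' q0' q' : link x' y' q0' q' -> ~ pair_nbrs q0' x' ->
    forall w, w \in H -> e (last q0' q') w -> same_sector y' w -> w = y'.
  move=> lk' np' w wH ew cyw; have [_ hf] := hits_far lk' np'.
  have [_ _ /and4P[_ e1y _ yU] nc _] := lk'.
  by apply/esym/hf => //; move: yU; rewrite inE => /andP[].
have sy := single_last _ _ _ _ lk np; split=> //.
have := single_last _ _ _ _ (link_rev e_simple lk); rewrite last_rev_belast; apply.
move=> [z [z' [ezz' [cz cz'] [ez ez'] [zH z'H] _]]].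
by move: ezz'; rewrite (sy z) // (sy z') // adjxx.
Qed.

Lemma single_nonpair r x :
  (forall w, w \in H -> e r w -> same_sector x w -> w = x) -> ~ pair_nbrs r x.
Proof.
move=> sx [z [z' [ezz' [cz cz'] [ez ez'] [zH z'H] _]]].
by move: ezz'; rewrite (sx z) // (sx z') // adjxx.
Qed.

(** The theta has ends [x] and [y]; its paths are the two arcs of H and the one through
    [q0 :: q]. *)
Lemma theta_single x y q0 q : link x y q0 q ->
  (forall r w, r \in q0 :: q -> w \in H -> e r w -> w = x \/ w = y) -> False.
Proof.
move=> [iq qo /and4P[e0x e1y xU yU] nc att] Qxy.
have [xH yH] : x \in H /\ y \in H.
  by move: xU yU; rewrite !inE => /andP[-> _] /andP[-> _].
have [k _ xk] := cyc_at cyc_g xH.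
have [h [ch x0]] : exists h, cyclic_enum e n h H /\ x = h 0.
  by exists (fun i => g (k + i)); rewrite addn0; split=> //; apply: cyc_shift.
have [n4 hn memH injh eh] := ch; have [j ltj yj] := cyc_at ch yH.
have nexy : ~~ e x y by apply: contra nc => exy; apply: conn1.
have xy : x != y by apply: contraNneq nc => ->; apply: conn_refl.
have jn : 2 <= j <= n - 2.
  move: nexy xy; rewrite x0 yj eh ?(cyc_inj ch) //; graph_lia.
have qH r : r \in q0 :: q -> r \notin H by case/qo/outsideP.
have fq a b : 0 < a -> b < n -> ~~ (a <= j <= b) -> far e (ivl h a b) [set r in q0 :: q].
  move=> a0 bn jab; apply: (far_outside ch) => // r i rQ iab; apply/negP=> er.
  have [] := Qxy r (h i) rQ (cyc_in _ ch) er; rewrite ?x0 ?yj => /eqP;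
    rewrite (cyc_inj ch) //; graph_lia.
apply: (@three_legs_absurd x y (ivl h 1 j.-1) (ivl h j.+1 n.-1) [set r in q0 :: q]
  (h 1) (h j.-1) (h n.-1) (h j.+1) q0 (last q0 q)) => //.
- split; rewrite ?x0 ?yj ?(ivl_notin ch) ?ivl_mem ?eh //; try graph_lia;
    by [split; graph_lia | apply: (ivl_conn ch); graph_lia].
- split; rewrite ?x0 ?yj ?(ivl_notin ch) ?ivl_mem ?eh //; try graph_lia;
    by [split; graph_lia | apply: (ivl_conn ch); graph_lia].
- split; rewrite ?in_set ?mem_head //.
  + by apply/negP=> /qH; rewrite xH.
  + by apply/negP=> /qH; rewrite yH.
  + by rewrite adjC e0x adjC e1y.
  + apply: (path_conn e_simple (induced_path_path iq)); rewrite ?mem_head ?mem_last //.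
    by move=> r; rewrite in_set.
- by apply: (far_ivl ch); graph_lia.
- by apply: fq; graph_lia.
- by apply: fq; graph_lia.
Qed.

(* The hypotheses say that H is the 6-cycle (h 0, h i, h l, y, h 4, z). *)
Lemma gap_absurd h l i y z : 7 <= n -> sector_frame e H c n h l -> 0 < i < l ->
  y = h l.+1 -> z = h n.-1 -> l.+2 < n ->
  ~~ same_sector (h i) y -> ~~ same_sector (h i) z -> ~~ same_sector y z ->
  adjacent_gap y (h i) -> adjacent_gap z (h i) ->
  adjacent_gap y z -> adjacent_gap z y -> False.
Proof.
move=> n7 fr il yl zn ln ncxy ncxz ncyz gyx gzx gyz gzy.
have [ch ec0 ecl nec ln'] := fr; have [n4 hn memH injh eh] := ch.
have far_y k : 0 < k < l -> ~~ same_sector y (h k).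
  move=> kl; apply: contra ncxy => cy; rewrite same_sectorC; apply: same_sector_trans cy _.
  exact: (frame_same_sector e_simple fr).
have far_z k : 0 < k < l -> ~~ same_sector z (h k).
  move=> kl; apply: contra ncxz => cz; rewrite same_sectorC; apply: same_sector_trans cz _.
  exact: (frame_same_sector e_simple fr).
have nczy : ~~ same_sector z y by rewrite same_sectorC.
have pos y' k : k < n -> adjacent_gap y' (h k) -> exists t t',
    [/\ t < n, t' < n, e c (h t), same_sector y' (h t') &
     [|| t.+1 == k, k.+1 == t, (t == 0) && (k.+1 == n) | (k == 0) && (t.+1 == n)] /\
     [|| t.+1 == t', t'.+1 == t, (t == 0) && (t'.+1 == n) | (t' == 0) && (t.+1 == n)]].
  move=> ltk [u [x' [/(cyc_at ch)[t ltt ->] ect et /(cyc_at ch)[t' ltt' ->] [et' ct']]]].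
  by exists t, t'; rewrite -!eh.
have noc k : e c (h k) -> 0 < k < l -> False.
  by move=> eck /nec; rewrite eck.
(* The gap vertex next to [h i] cannot be [h 0], whose neighbours [h 1] and [z] are not in the
   sector of [y]; so it is [h l]. *)
have il1 : i.+1 = l.
  have [|t [t' [ltt ltt' ect cyt' [tt tt']]]] := pos y i _ gyx; first graph_lia.
  have nt := noc _ ect; have ny : ~ (0 < t' < l) by move/far_y; rewrite cyt'.
  have nz : t' <> n.-1 by move=> tn; move: ncyz; rewrite zn -tn cyt'.
  graph_lia.
have i1 : i = 1.
  have [|t [t' [ltt ltt' ect czt' [tt tt']]]] := pos z i _ gzx; first graph_lia.
  have nt := noc _ ect; have nz : ~ (0 < t' < l) by move/far_z; rewrite czt'.
  have ny : t' <> l.+1 by move=> tl; move: nczy; rewrite yl -tl czt'.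
  graph_lia.
have l2 : l = 2 by graph_lia.
(* The gap next to [y = h 3] is not at [h 2], so it is at [h 4], and the sector of [y] has [h 3] as
   its only interior vertex. *)
subst i l; have ec4 : e c (h 4).
  rewrite yl in gzy; have [|t [t' [ltt ltt' ect czt' [tt tt']]]] := pos z 3 _ gzy; first graph_lia.
  have nz : ~ (0 < t' < 2) by move/far_z; rewrite czt'.
  have ny : t' <> 3 by move=> tl; move: nczy; rewrite yl -tl czt'.
  by have <- : t = 4 by graph_lia.
rewrite zn in gyz; have [|t [t' [ltt ltt' ect cyt' [tt tt']]]] := pos y n.-1 _ gyz; first graph_lia.
have ny : ~ (0 < t' < 2) by move/far_y; rewrite cyt'.
have nz : t' <> n.-1 by move=> tn; move: ncyz; rewrite zn -tn cyt'.
(* Now [h (n - 3)] is in the sector of [y], so it is [h 3] and [n] would be six. *)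
have t'n : t' = n - 3 by graph_lia.
rewrite yl in cyt'; have [||j j4 /injh] := same_sector_between ch _ ecl ec4 _ cyt'; graph_lia.
Qed.

(** Both ends attach by single vertices. If nothing else is seen, [theta_single] applies; otherwise
    one vertex sees three sectors that are pairwise one gap apart, which forces a hole of length
    six. *)
Lemma nonpair_absurd x y q0 q : 7 <= n -> link x y q0 q -> ~ pair_nbrs q0 x -> False.
Proof.
move=> n7 lk np; have [sx sy] := link_nonpair_single lk np.
have [iq qo /and4P[e0x e1y xU yU] nc att] := lk.
have [xH yH] : x \in H /\ y \in H.
  by move: xU yU; rewrite !inE => /andP[-> _] /andP[-> _].
case: q lk sy e1y iq qo att => [|q1 q] lk sy e1y iq qo att; last first.
  apply: (theta_single lk) => r w rq wH erw.
  have [//|[rq0 cw]|[rq1 cw]] := att r w rq wH erw; rewrite ?rq0 ?rq1 in erw.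
    by left; apply: sx.
  by right; apply: sy.
case: (boolP [exists z in H, [&& e q0 z, z != x & z != y]]); last first.
  move=> nz; apply: (theta_single lk) => r w; rewrite inE => /eqP-> wH ew.
  have [->|wx] := eqVneq w x; first by left.
  have [->|wy] := eqVneq w y; first by right.
  by case/negP: nz; apply/exists_inP; exists w; rewrite // ew wx.
(* Each of [x], [y], [z] can now serve as an end of a link through [q0]. *)
case/exists_inP=> z zH /and3P[ez zx zy]; rewrite /= in sy e1y.
have ncxz : ~~ same_sector x z by apply: contra zx => cz; apply/eqP/sx.
have ncyz : ~~ same_sector y z by apply: contra zy => cz; apply/eqP/sy.
have lkxz := link_single lk xH zH e0x ez ncxz.
have lkyx : link y x q0 [::] by apply: (link_single lk) => //; rewrite same_sectorC.
have lkzx : link z x q0 [::] by apply: (link_single lk) => //; rewrite same_sectorC.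
have [_ sz] := link_nonpair_single lkxz np.
have npy := single_nonpair sy; have npz := single_nonpair sz.
have [gapy _] := hits_far lkyx npy; have [gapz _] := hits_far lkzx npz.
have [h [l [i [fr il xi]]]] := frame_exists c3 cyc_g xU.
rewrite xi in lk np lkxz.
have ncyx : ~~ same_sector y x by rewrite same_sectorC.
have nczx : ~~ same_sector z x by rewrite same_sectorC.
have nczy : ~~ same_sector z y by rewrite same_sectorC.
have [j [jl yj _ jj]] : exists k, [/\ l < k < n, y = h k, ~~ e c (h k) & k = l.+1 \/ k.+1 = n].
  by apply: (hits_pos fr il lk np); rewrite // -xi.
have [k [kl zk _ kk]] : exists k, [/\ l < k < n, z = h k, ~~ e c (h k) & k = l.+1 \/ k.+1 = n].
  by apply: (hits_pos fr il lk np); rewrite // -xi.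
have jk : j != k by apply: contraNneq zy => jk; rewrite zk yj jk.
have gyx : adjacent_gap y (h i) by rewrite -xi; apply: gapy.
have gzx : adjacent_gap z (h i) by rewrite -xi; apply: gapz.
have gyz : adjacent_gap y z by apply: gapy.
have gzy : adjacent_gap z y by apply: gapz.
have ln : l.+2 < n by graph_lia.
rewrite xi in nc ncxz; have [[jE kE]|[jE kE]] : (j = l.+1 /\ k = n.-1) \/ (j = n.-1 /\ k = l.+1) by graph_lia.
  by rewrite jE in yj; rewrite kE in zk; apply: (gap_absurd n7 fr il yj zk ln).
by rewrite jE in yj; rewrite kE in zk; apply: (gap_absurd n7 fr il zk yj ln).
Qed.

(** * Attachments that are pairs of adjacent vertices *)

Lemma nonZ_nonadj x y : x \in nonZ -> y \in nonZ -> ~~ same_sector x y -> ~~ e x y.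
Proof. by move=> xU yU; apply: contra => exy; apply: conn1. Qed.

(** The pair is made to straddle the origin, the position that [prism_cyc] expects. *)
Lemma pair_shift r x : pair_nbrs r x -> exists h,
  [/\ cyclic_enum e n h H, same_sector x (h 0) /\ same_sector x (h n.-1), e r (h 0) /\ e r (h n.-1)
    & forall w, w \in H -> same_sector x w -> e r w -> w = h 0 \/ w = h n.-1].
Proof.
case=> z [z' [ezz' [cz cz'] [ez ez'] [/(cyc_at cyc_g)[k _ zk] z'H] rz]].
have [h [ch z0]] : exists h, cyclic_enum e n h H /\ z = h 0.
  by exists (fun i => g (k + i)); rewrite addn0; split=> //; apply: cyc_shift.
have [n4 hn memH injh eh] := ch; have [j ltj zj] := cyc_at ch z'H.
rewrite z0 zj eh in ezz'; [|graph_lia|by []].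
have [j1|jn] : j = 1 \/ j = n.-1 by graph_lia.
  have h'0 : h (1 + 0) = z' by rewrite zj j1.
  have h'n : h (1 + n.-1) = z.
    by rewrite add1n prednK ?(leq_trans _ n4) // -[n]addn0 hn.
  exists (fun i => h (1 + i)); rewrite h'0 h'n; split=> //; first exact: cyc_shift.
  by move=> w wH cw ew; apply/or_comm; apply: rz.
by exists h; rewrite -z0 -jn -zj.
Qed.

(** Since [h 0] is in another sector, the pair does not wrap around. *)
Lemma pair_pos h r x : cyclic_enum e n h H -> pair_nbrs r x -> ~~ same_sector x (h 0) ->
  exists j, [/\ 0 < j /\ j.+1 < n, same_sector x (h j) /\ same_sector x (h j.+1), e r (h j) /\ e r (h j.+1)
    & forall w, w \in H -> same_sector x w -> e r w -> w = h j \/ w = h j.+1].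
Proof.
move=> ch [z [z' [ezz' [cz cz'] [ez ez'] [/(cyc_at ch)[k ltk zk] /(cyc_at ch)[k' ltk' zk']] rz]]] nc0.
have [n4 hn memH injh eh] := ch; subst z z'.
have k0 : k != 0 by apply: contraNneq nc0 => <-.
have k'0 : k' != 0 by apply: contraNneq nc0 => <-.
rewrite eh // in ezz'; have [k'k|kk'] : k' = k.+1 \/ k = k'.+1 by graph_lia.
  by subst k'; exists k; split=> //; split; graph_lia.
subst k; exists k'; split=> //; first by split; graph_lia.
by move=> w wH cw ew; apply/or_comm; apply: rz.
Qed.

Lemma c_between h i j : cyclic_enum e n h H -> i <= j -> h i \in nonZ -> h j \in nonZ ->
  ~~ same_sector (h i) (h j) -> exists2 t, i < t < j & e c (h t).
Proof.
move=> ch ij iU jU nc.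
case: (boolP [exists t : 'I_j, (i < t) && e c (h t)]) => [/existsP[t /andP[it ect]]|nt].
  by exists (val t); rewrite ?it ?ltn_ord.
case/negP: nc; apply: (same_sector_seg e_simple ch (a := i) (b := j)); rewrite ?leqnn ?ij //.
move=> t /andP[it tj]; have [<-|it'] := eqVneq i t; first by move: iU; rewrite inE => /andP[].
have [->|tj'] := eqVneq t j; first by move: jU; rewrite inE => /andP[].
have ltj : t < j by rewrite ltn_neqAle tj' tj.
apply/negP=> ect; case/negP: nt; apply/existsP; exists (Ordinal ltj).
by rewrite /= ect andbT ltn_neqAle it' it.
Qed.

(** Each arc between consecutive pairs joins two sectors, so it contains a neighbour of [c].
    Dropping the last vertex of each arc makes the three arcs pairwise anticomplete, and they give a
    theta between [r] and [c]. *)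
Lemma three_arcs_absurd h r j k : cyclic_enum e n h H -> r \in outside ->
  0 < j -> j.+1 < k -> k.+1 < n.-1 -> e r (h 0) -> e r (h j) -> e r (h j.+1) ->
  e r (h k) -> e r (h k.+1) -> e r (h n.-1) ->
  ~~ same_sector (h 0) (h j) -> ~~ same_sector (h j.+1) (h k) -> ~~ same_sector (h k.+1) (h n.-1) -> False.
Proof.
move=> ch ro j0 jk kn e0 ej ej1 ek ek1 en nc1 nc2 nc3.
have [rH rc ecr rU] := outsideP ro; have [n4 hn memH injh eh] := ch.
have hH i : h i \in H by apply: cyc_in ch.
have [t1 t1j ect1] := c_between ch (leq0n _) (rU _ (hH _) e0) (rU _ (hH _) ej) nc1.
have [t2 t2j ect2] := c_between ch (ltnW jk) (rU _ (hH _) ej1) (rU _ (hH _) ek) nc2.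
have [t3 t3j ect3] := c_between ch (ltnW kn) (rU _ (hH _) ek1) (rU _ (hH _) en) nc3.
apply: (@three_legs_absurd r c (ivl h 0 j.-1) (ivl h j.+1 k.-1) (ivl h k.+1 (n - 2))
   (h 0) (h t1) (h j.+1) (h t2) (h k.+1) (h t3)) => //; first by rewrite adjC.
1-3: split; rewrite ?(outside_notin_ivl _ _ ch) ?ivl_mem //; try graph_lia; apply: (ivl_conn ch); graph_lia.
all: apply: (far_ivl ch); graph_lia.
Qed.

Lemma pair_nbrs_dec r x : pair_nbrs r x \/ ~ pair_nbrs r x.
Proof.
case: (boolP [exists z in H, [exists z' in H,
  [&& e z z', same_sector x z, same_sector x z', e r z, e r z' &
    [forall w in H, same_sector x w ==> e r w ==> (w == z) || (w == z')]]]]) => nz; [left|right].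
  case/exists_inP: nz => z zH /exists_inP[z' z'H /and5P[ezz' cz cz' ez /andP[ez' rz]]].
  exists z, z'; split=> // w wH cw ew.
  by have := forall_inP rz w wH; rewrite cw ew => /orP[] /eqP->; [left | right].
case=> z [z' [ezz' [cz cz'] [ez ez'] [zH z'H] rz]]; case/negP: nz.
apply/exists_inP; exists z => //; apply/exists_inP; exists z' => //.
rewrite ezz' cz cz' ez ez'; apply/forall_inP=> w wH; apply/implyP=> cw; apply/implyP=> ew.
by case: (rz w wH cw ew) => ->; rewrite eqxx ?orbT.
Qed.

Lemma pairs_absurd x y q0 q : link x y q0 q ->
  pair_nbrs q0 x -> pair_nbrs (last q0 q) y ->
  (q = [::] -> forall z, z \in H -> e q0 z -> pair_nbrs q0 z) -> False.
Proof.
move=> lk px py pz; have [iq qo /and4P[e0x e1y xU yU] nc att] := lk.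
have [h [ch [cx0 cxn] [ex0 exn] x_nbrs]] := pair_shift px.
have [n4 hn memH injh eh] := ch.
have hH i : h i \in H by apply: cyc_in ch.
have ncxy u v : same_sector x u -> same_sector y v -> ~~ same_sector u v.
  move=> cu cv; apply: contra nc => cuv; apply: same_sector_trans cu _; apply: same_sector_trans cuv _.
  by rewrite same_sectorC.
have ncy0 : ~~ same_sector y (h 0).
  by apply: contra nc => cy; apply: same_sector_trans cx0 _; rewrite same_sectorC.
have [j [[j0 jn] [cyj cyj1] [eyj eyj1] y_nbrs]] := pair_pos ch py ncy0.
have uU u v : same_sector u v -> u \in nonZ -> v \in nonZ by apply: same_sector_nonZ.
have ej0 := nonZ_nonadj (uU _ _ cx0 xU) (uU _ _ cyj yU) (ncxy _ _ cx0 cyj).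
have ejn := nonZ_nonadj (uU _ _ cxn xU) (uU _ _ cyj1 yU) (ncxy _ _ cxn cyj1).
have jn1 : j.+1 != n.-1.
  apply/eqP=> jn1; have := ncxy _ _ cxn cyj1; by rewrite jn1 same_sector_refl.
rewrite eh in ej0; [|graph_lia|graph_lia]; rewrite eh in ejn; [|graph_lia|graph_lia].
(* Vertices of different sectors are not adjacent, so at least one vertex separates the two pairs on
   either side. *)
have [j2 j4] : 2 <= j /\ j + 4 <= n by split; graph_lia.
case: (boolP [exists w in H, [&& q == [::], e q0 w, ~~ same_sector x w & ~~ same_sector y w]]); last first.
  move=> nw; have [||X] := @prism_cyc _ e e_simple n h H q0 q j ch j2 j4 iq; last exact: e_prism_free.
    by move=> r /qo/outsideP[].
  move=> r i rq lti; apply/idP/idP; last first.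
    case/orP=> /andP[/eqP-> /orP[] /eqP ii]; rewrite ?ii //.
    by rewrite (_ : i = n.-1) //; graph_lia.
  move=> er; have posx : same_sector x (h i) -> e q0 (h i) -> (i == 0) || (i.+1 == n).
    move=> cx ex; have [] := x_nbrs _ (hH i) cx ex => /injh ei.
      by rewrite ei //; graph_lia.
    by rewrite ei //; graph_lia.
  have posy : same_sector y (h i) -> e (last q0 q) (h i) -> (i == j) || (i == j.+1).
    move=> cy ey; have [] := y_nbrs _ (hH i) cy ey => /injh ei.
      by rewrite ei ?eqxx //; graph_lia.
    by rewrite ei ?eqxx ?orbT //; graph_lia.
  have [q_nil|[rq0 cx]|[rq1 cy]] := att r _ rq (hH i) er.
  - have rq0 : r = q0 by move: rq; rewrite q_nil inE => /eqP.
    have [cx|ncx] := boolP (same_sector x (h i)).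
      by rewrite rq0 eqxx posx // -rq0.
    have [cy|ncy] := boolP (same_sector y (h i)).
      by rewrite rq0 q_nil /= eqxx posy ?orbT // q_nil /= -rq0.
    case/negP: nw; apply/exists_inP; exists (h i) => //.
    by rewrite q_nil eqxx -rq0 er ncx ncy.
  - by rewrite rq0 eqxx posx // -rq0.
  - by rewrite rq1 eqxx posy ?orbT // -rq1.
case/exists_inP=> z zH /and4P[/eqP q_nil ez ncxz ncyz]; subst q.
have pzz := pz erefl z zH ez; rewrite /= in eyj eyj1.
have q0o : q0 \in outside by apply: qo; apply: mem_head.
have zU : z \in nonZ by have [_ _ _] := outsideP q0o; apply.
have ncxz' u v : same_sector x u -> same_sector z v -> ~~ same_sector u v.
  move=> cu cv; apply: contra ncxz => cuv; apply: same_sector_trans cu _; apply: same_sector_trans cuv _.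
  by rewrite same_sectorC.
have ncyz' u v : same_sector y u -> same_sector z v -> ~~ same_sector u v.
  move=> cu cv; apply: contra ncyz => cuv; apply: same_sector_trans cu _; apply: same_sector_trans cuv _.
  by rewrite same_sectorC.
have ncz0 : ~~ same_sector z (h 0).
  by apply: contra ncxz => cz; apply: same_sector_trans cx0 _; rewrite same_sectorC.
have [k [[k0 kn] [czk czk1] [ezk ezk1] _]] := pair_pos ch pzz ncz0.
have kn1 : k.+1 != n.-1.
  by apply/eqP=> kn1; have := ncxz' _ _ cxn czk1; rewrite kn1 same_sector_refl.
have jk0 : j != k.
  by apply/eqP=> jk; have := ncyz' _ _ cyj czk; rewrite jk same_sector_refl.
have jk1 : j.+1 != k.
  by apply/eqP=> jk; have := ncyz' _ _ cyj1 czk; rewrite jk same_sector_refl.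
have jk2 : j != k.+1.
  by apply/eqP=> jk; have := ncyz' _ _ cyj czk1; rewrite jk same_sector_refl.
(* The third pair lies on either side of the second; the two orders are symmetric. *)
have [jk|kj] : j.+1 < k \/ k.+1 < j by graph_lia.
  apply: (three_arcs_absurd ch q0o j0 jk) => //; try graph_lia.
  - exact: ncxy.
  - exact: ncyz'.
  - by rewrite same_sectorC; apply: ncxz'.
apply: (three_arcs_absurd ch q0o k0 kj) => //; try graph_lia.
- exact: ncxz'.
- by rewrite same_sectorC; apply: ncyz'.
- by rewrite same_sectorC; apply: ncxy.
Qed.

End Hits.

(** * From the absence of links to a separation *)

Theorem theorem3p1 (T : finType) (e : rel T) (H : {set T}) (c a b : T)
    (Sa Sb : {set T}) (ua va ub vb : T)
    (e_simple : simple_graph e)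
    (e_theta_free : theta_free e) (e_prism_free : prism_free e)
    (W_wheel : wheel e H c) (W_non_special : ~ special e H c)
    (H_length : 7 <= #|H|)
    (a_notin : a \notin closed_nbhd e (wheelZ e H c))
    (b_notin : b \notin closed_nbhd e (wheelZ e H c))
    (Sa_sector : sector_between e H c ua va Sa)
    (Sb_sector : sector_between e H c ub vb Sb)
    (Sa_neq_Sb : Sa <> Sb)
    (a_interior : a \in interior ua va Sa)
    (b_interior : b \in interior ub vb Sb) :
  separates e (closed_nbhd e (wheelZ e H c)) a b.
Proof.
have [Hhole cH c3] := W_wheel; have [h ch] := hole_cyc Hhole.
have [aU _] := mem_sector e_simple ch Sa_sector a_interior.
have [bU _] := mem_sector e_simple ch Sb_sector b_interior.
have aH : a \in H by move: aU; rewrite inE => /andP[].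
have bH : b \in H by move: bU; rewrite inE => /andP[].
have ncab : ~~ same_sector e H c a b.
  apply/negP=> cab; apply: Sa_neq_Sb.
  exact: (sector_eq e_simple ch Sa_sector Sb_sector a_interior b_interior cab).
set M := closed_nbhd e (wheelZ e H c) in a_notin b_notin *.
have ncM : ~~ conn e (~: M) a b.
  apply/negP=> cM; have [x [y [q0 [q lk]]]] := link_exists e_simple ch aH bH b_notin ncab cM.
  have pair_link x' y' r p : link e H c x' y' r p -> pair_nbrs e H c r x'.
    move=> lk'; have [//|np] := pair_nbrs_dec e H c r x'.
    by have := nonpair_absurd e_simple c3 cH e_theta_free e_prism_free W_non_special ch H_length lk' np.
  apply: (pairs_absurd e_simple cH e_theta_free e_prism_free ch lk).
  - exact: pair_link lk.
  - exact: pair_link (link_rev e_simple lk).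
  (* Any [z] seen by a single vertex becomes an end of a link, the other end being whichever of [x]
     and [y] lies in another sector. *)
  - move=> q_nil z zH ez; subst q; have [_ _ /and4P[ex ey xU yU] nc _] := lk.
    have [xH yH] : x \in H /\ y \in H.
      by move: xU yU; rewrite !inE => /andP[-> _] /andP[-> _].
    have [czx|nczx] := boolP (same_sector e H c z x).
      apply: (pair_link z y q0 [::]); apply: (link_single lk) => //.
      apply: contra nc; apply: conn_trans; by rewrite -/(same_sector e H c x z) same_sector_sym.
    by apply: (pair_link z x q0 [::]); apply: (link_single lk).
clearbody M; split.
  by apply/subsetP=> z zM; rewrite !inE negb_or; apply/andP; split;
    apply: contraTneq zM => ->.
(* The component of [a] in the complement of [M], against the rest of that complement. *)
exists [set z in ~: M | conn e (~: M) a z], [set z in ~: M | ~~ conn e (~: M) a z].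
have disjS (A B : {set T}) : (forall z, z \in A -> z \notin B) -> [disjoint A & B].
  move=> AB; apply/pred0P=> z; apply/negP=> /andP[/AB/negP zB /zB]; exact.
split; last 2 first.
- by rewrite !inE a_notin conn_refl.
- by rewrite !inE b_notin ncM.
split.
- split; apply: disjS => z; rewrite !inE.
  + by case/andP=> /negPf->.
  + by case/andP=> _ ->; rewrite andbF.
  + by move=> ->.
- apply/setP=> z; rewrite !inE; case: (z \in M); rewrite ?orbT //=.
  by case: conn.
- by apply/set0Pn; exists a; rewrite !inE a_notin conn_refl.
- by apply/set0Pn; exists b; rewrite !inE b_notin ncM.
move=> u v; rewrite !inE => /andP[uM cau] /andP[vM ncav].
apply: contra ncav => euv; apply: conn_trans cau _.
by apply: conn1; rewrite ?in_setC.
Qed.
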